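(* Let $S_y$ and $S_x$ be two simple right $C$-comodules with $x\in I_e$. Then $S_y\subseteq S(S_x)/S_x$ if and only if $S_y\subseteq E_x/S_x$ and $T(S_y)=0$.
   Context: Let $K$ be a field and $C$ a basic $K$-coalgebra (the socle of the right $C$-comodule $C$ is a direct sum of pairwise non-isomorphic simple comodules), which is also assumed indecomposable as a coalgebra. All comodules are right comodules, $\mathcal{M}^C$ is the category of right $C$-comodules. $\{S_x\}_{x\in I_C}$ is a complete set of pairwise non-isomorphic simple right $C$-comodules, $E_x$ is the injective envelope of $S_x$. For a simple comodule $S_y$ and a comodule $M$, $S_y\subseteq M$ means that $S_y$ is isomorphic to a subcomodule of $M$. Fix an idempotent $e\in C^*$. It acts on a right comodule $M$ by $em=\sum m_{(0)}e(m_{(1)})$, and on $C$ by $ec=\sum c_{(1)}e(c_{(2)})$, $ce=\sum e(c_{(1)})c_{(2)}$. The space $eCe$ is a coalgebra with $\Delta(ece)=\sum ec_{(1)}e\otimes ec_{(2)}e$ and counit the restriction of that of $C$. The quotient functor is the exact functor $T:\mathcal{M}^C\to\mathcal{M}^{eCe}$, $T(M)=eM\cong M\square_C eC$, and the section functor is its right adjoint $S:\mathcal{M}^{eCe}\to\mathcal{M}^C$, $S(N)=N\square_{eCe}Ce$. Put $I_e=\{x\in I_C: T(S_x)\neq0\}$; the comodules $T(S_x)$, $x\in I_e$, again denoted $S_x$, form a complete set of pairwise non-isomorphic simple $eCe$-comodules. For $x\in I_e$, $S(S_x)$ (the functor $S$ applied to the simple $eCe$-comodule $S_x$) is a subcomodule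 of $E_x$ containing $S_x=\operatorname{Soc}E_x$. *)

(* Defs.v *)
From HB Require Import structures.
From mathcomp Require Import all_boot all_algebra.
From mathcomp Require Import generic_quotient boolp classical_sets.

Set Implicit Arguments.
Unset Strict Implicit.
Unset Printing Implicit Defensive.

Import GRing.Theory.
Local Open Scope ring_scope.
Local Open Scope quotient_scope.

Reserved Notation "V \otimes W" (at level 40, left associativity).
Reserved Notation "v \ot w" (at level 40, left associativity).

(* The tensor product over K: formal sums of pairs, two of them being         *)
(* identified when every bilinear map takes the same value on both.           *)

Section Tensor.
Variables (K : fieldType) (V W : lmodType K).

Definition tsum (U : lmodType K) (f : V -> W -> U) (s : seq (V * W)) : U :=
  \sum_(p <- s) f p.1 p.2.

Definition tensor_rel (s t : seq (V * W)) : bool :=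
  `[< forall (U : lmodType K) (f : {bilinear V -> W -> U}),
        tsum f s = tsum f t >].

Lemma tensor_rel_equiv : equiv_class_of tensor_rel.
Proof.
split=> [s|s t|t s u].
- exact/asboolP.
- by apply/asboolP/asboolP => h U f; rewrite h.
- by move=> /asboolP st /asboolP tu; apply/asboolP => U f; rewrite st tu.
Qed.

Canonical tensor_equiv := EquivRelPack tensor_rel_equiv.

Definition tensor : Type := {eq_quot tensor_equiv}.

HB.instance Definition _ := Choice.on tensor.
HB.instance Definition _ := Quotient.on tensor.
HB.instance Definition _ := EqQuotient.on tensor.

Lemma tensor_pi_eq (s t : seq (V * W)) :
  (forall (U : lmodType K) (f : {bilinear V -> W -> U}), tsum f s = tsum f t) ->
  \pi_tensor s = \pi_tensor t.
Proof. by move=> h; apply/eqquotP/asboolP. Qed.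

Lemma tsum_repr (U : lmodType K) (f : {bilinear V -> W -> U}) s :
  tsum f (repr (\pi_tensor s)) = tsum f s.
Proof.
by have /eqquotP/asboolP := reprK (\pi_tensor s); apply.
Qed.

Definition tscale (a : K) (s : seq (V * W)) := [seq (a *: p.1, p.2) | p <- s].

Lemma tsum_cat (U : lmodType K) (f : V -> W -> U) s t :
  tsum f (s ++ t) = tsum f s + tsum f t.
Proof. by rewrite /tsum big_cat. Qed.

Lemma tsum_scale (U : lmodType K) (f : {bilinear V -> W -> U}) a s :
  tsum f (tscale a s) = a *: tsum f s.
Proof.
by rewrite /tsum big_map scaler_sumr; apply: eq_bigr => p _ /=; rewrite linearZl_LR.
Qed.

Definition tadd (x y : tensor) : tensor := \pi_tensor (repr x ++ repr y).
Definition tzero : tensor := \pi_tensor [::].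
Definition topp (x : tensor) : tensor := \pi_tensor (tscale (-1) (repr x)).
Definition tscl (a : K) (x : tensor) : tensor := \pi_tensor (tscale a (repr x)).

(* Equality of tensors, tested on bilinear maps. *)
Lemma tensorP (x y : tensor) :
  (forall (U : lmodType K) (f : {bilinear V -> W -> U}),
      tsum f (repr x) = tsum f (repr y)) -> x = y.
Proof. by move=> h; rewrite -[x]reprK -[y]reprK; apply: tensor_pi_eq. Qed.

Let tE := (tsum_repr, tsum_cat, tsum_scale).

Lemma taddA : associative tadd.
Proof. by move=> x y z; apply: tensorP => U f; rewrite !tE addrA. Qed.
Lemma taddC : commutative tadd.
Proof. by move=> x y; apply: tensorP => U f; rewrite !tE addrC. Qed.
Lemma tadd0 : left_id tzero tadd.
Proof. by move=> x; apply: tensorP => U f; rewrite !tE /tsum big_nil add0r. Qed.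
Lemma taddN : left_inverse tzero topp tadd.
Proof.
by move=> x; apply: tensorP => U f; rewrite !tE scaleN1r addNr /tsum big_nil.
Qed.

HB.instance Definition _ := GRing.isZmodule.Build tensor taddA taddC tadd0 taddN.

Lemma tsclA a b x : tscl a (tscl b x) = tscl (a * b) x.
Proof. by apply: tensorP => U f; rewrite !tE scalerA. Qed.
Lemma tscl1 : left_id 1 tscl.
Proof. by move=> x; apply: tensorP => U f; rewrite !tE scale1r. Qed.
Lemma tsclDr : right_distributive tscl +%R.
Proof. by move=> a x y; apply: tensorP => U f; rewrite !tE scalerDr. Qed.
Lemma tsclDl x : {morph tscl^~ x : a b / a + b}.
Proof. by move=> a b; apply: tensorP => U f; rewrite !tE scalerDl. Qed.

HB.instance Definition _ :=
  GRing.Zmodule_isLmodule.Build K tensor tsclA tscl1 tsclDr tsclDl.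

Definition tens (v : V) (w : W) : tensor := \pi_tensor [:: (v, w)].

Lemma tsum1 (U : lmodType K) (f : V -> W -> U) v w : tsum f [:: (v, w)] = f v w.
Proof. by rewrite /tsum big_seq1. Qed.

Lemma tens_bilinear : bilinear_for *:%R *:%R tens.
Proof.
split=> [w|v] a x y /=; apply: tensorP => U f;
  rewrite !tE !tsum1 !(linearDl, linearZl_LR, linearDr, linearZr_LR) //=.
Qed.

HB.instance Definition _ :=
  bilinear_isBilinear.Build K V W tensor *:%R *:%R tens tens_bilinear.

Section Lift.
Variables (U : lmodType K) (f : {bilinear V -> W -> U}).

Definition tlift (x : tensor) : U := tsum f (repr x).

Lemma tlift_linear : linear tlift.
Proof. by move=> a x y; rewrite /tlift !tE. Qed.

HB.instance Definition _ := GRing.isLinear.Build K tensor U *:%R tlift tlift_linear.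

Lemma tliftE v w : tlift (tens v w) = f v w.
Proof. by rewrite /tlift !tE tsum1. Qed.

End Lift.

Lemma tens_repr x : x = \sum_(p <- repr x) tens p.1 p.2.
Proof.
apply: tensorP => U f; rewrite -!/(tlift f _) linear_sum /=.
by apply: eq_bigr => p _; rewrite tliftE.
Qed.

Lemma tens_ind (P : tensor -> Prop) :
  (forall v w, P (tens v w)) -> (forall x y, P x -> P y -> P (x + y)) ->
  forall x, P x.
Proof.
move=> P1 PD x; rewrite (tens_repr x); elim: (repr x) => [|p s IHs].
  by have := P1 0 0; rewrite big_nil linear0l.
by rewrite big_cons; apply: PD.
Qed.

Lemma tens_ext (U : lmodType K) (f g : {linear tensor -> U}) :
  (forall v w, f (tens v w) = g (tens v w)) -> f =1 g.
Proof. by move=> h; apply: tens_ind => // x y; rewrite !linearD => -> ->. Qed.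

End Tensor.

Notation "V \otimes W" := (tensor V W) : type_scope.
Notation "v \ot w" := (tens v w) : ring_scope.

Section TensorMaps.
Variable K : fieldType.
Implicit Types V W U X Y Z : lmodType K.

Section Map.
Variables (V V' W W' : lmodType K) (f : {linear V -> V'}) (g : {linear W -> W'}).

Definition tmap_bilin (v : V) (w : W) : V' \otimes W' := f v \ot g w.

Lemma tmap_bilinear : bilinear_for *:%R *:%R tmap_bilin.
Proof. by split=> [w|v] a x y; rewrite /tmap_bilin linearP ?linearPl ?linearPr. Qed.

HB.instance Definition _ := bilinear_isBilinear.Build K V W (V' \otimes W')
  *:%R *:%R tmap_bilin tmap_bilinear.

Definition tmap : V \otimes W -> V' \otimes W' := tlift tmap_bilin.
HB.instance Definition _ := GRing.Linear.on tmap.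

Lemma tmapE v w : tmap (v \ot w) = f v \ot g w.
Proof. exact: tliftE. Qed.

End Map.

Lemma tmap_comp V V' V'' W W' W'' (f : {linear V -> V'}) (g : {linear W -> W'})
    (f' : {linear V' -> V''}) (g' : {linear W' -> W''}) t :
  tmap f' g' (tmap f g t) = tmap (f' \o f) (g' \o g) t.
Proof.
by move: t; apply: tens_ind => [v w|x y hx hy]; rewrite ?tmapE // !linearD /= hx hy.
Qed.

Lemma eq_tmap V V' W W' (f f' : {linear V -> V'}) (g g' : {linear W -> W'}) :
  f =1 f' -> g =1 g' -> tmap f g =1 tmap f' g'.
Proof.
move=> hf hg; apply: tens_ind => [v w|x y hx hy]; rewrite ?tmapE ?hf ?hg //.
by rewrite !linearD /= hx hy.
Qed.

Lemma tmap_id V W (f : {linear V -> V}) (g : {linear W -> W}) :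
  f =1 id -> g =1 id -> tmap f g =1 id.
Proof.
move=> hf hg; apply: tens_ind => [v w|x y hx hy]; rewrite ?tmapE ?hf ?hg //.
by rewrite !linearD /= hx hy.
Qed.

Section Assoc.
Variables V W U : lmodType K.

Section L.
Variable u : U.
Definition tassocl_bilin (v : V) (w : W) : V \otimes (W \otimes U) := v \ot (w \ot u).
Lemma tassocl_bilinear : bilinear_for *:%R *:%R tassocl_bilin.
Proof. by split=> [w|v] a x y; rewrite /tassocl_bilin linearPl //= linearPr. Qed.
HB.instance Definition _ := bilinear_isBilinear.Build K V W
  (V \otimes (W \otimes U)) *:%R *:%R tassocl_bilin tassocl_bilinear.
End L.

Definition tassoc_bilin (t : V \otimes W) (u : U) : V \otimes (W \otimes U) :=
  tlift (tassocl_bilin u) t.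
Lemma tassoc_bilinear : bilinear_for *:%R *:%R tassoc_bilin.
Proof.
split=> [u|t] a x y; first by rewrite /tassoc_bilin linearP.
rewrite /tassoc_bilin; move: t; apply: tens_ind => [v w|s t hs ht].
  by rewrite !tliftE /= /tassocl_bilin linearPr /= linearPr.
by rewrite !linearD /= hs ht scalerDr addrACA.
Qed.
HB.instance Definition _ := bilinear_isBilinear.Build K (V \otimes W) U
  (V \otimes (W \otimes U)) *:%R *:%R tassoc_bilin tassoc_bilinear.

Definition tassoc : (V \otimes W) \otimes U -> V \otimes (W \otimes U) :=
  tlift tassoc_bilin.
HB.instance Definition _ := GRing.Linear.on tassoc.

Lemma tassocE v w u : tassoc (v \ot w \ot u) = v \ot (w \ot u).
Proof. by rewrite /tassoc tliftE /= /tassoc_bilin tliftE. Qed.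

Section R.
Variable v : V.
Definition tassocVr_bilin (w : W) (u : U) : (V \otimes W) \otimes U := v \ot w \ot u.
Lemma tassocVr_bilinear : bilinear_for *:%R *:%R tassocVr_bilin.
Proof.
split=> [u|w] a x y; rewrite /tassocVr_bilin; last by rewrite linearPr.
by rewrite [v \ot (_ + _)]linearPr /= linearPl.
Qed.
HB.instance Definition _ := bilinear_isBilinear.Build K W U
  ((V \otimes W) \otimes U) *:%R *:%R tassocVr_bilin tassocVr_bilinear.
End R.

Definition tassocV_bilin (v : V) (t : W \otimes U) : (V \otimes W) \otimes U :=
  tlift (tassocVr_bilin v) t.
Lemma tassocV_bilinear : bilinear_for *:%R *:%R tassocV_bilin.
Proof.
split=> [t|v] a x y; last by rewrite /tassocV_bilin linearP.
rewrite /tassocV_bilin; move: t; apply: tens_ind => [w u|s t hs ht].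
  by rewrite !tliftE /= /tassocVr_bilin linearPl /= linearPl.
by rewrite !linearD /= hs ht scalerDr addrACA.
Qed.
HB.instance Definition _ := bilinear_isBilinear.Build K V (W \otimes U)
  ((V \otimes W) \otimes U) *:%R *:%R tassocV_bilin tassocV_bilinear.

Definition tassocV : V \otimes (W \otimes U) -> (V \otimes W) \otimes U :=
  tlift tassocV_bilin.
HB.instance Definition _ := GRing.Linear.on tassocV.

Lemma tassocVE v w u : tassocV (v \ot (w \ot u)) = v \ot w \ot u.
Proof. by rewrite /tassocV tliftE /= /tassocV_bilin tliftE. Qed.

Lemma tens_ind3l (P : (V \otimes W) \otimes U -> Prop) :
  (forall v w u, P (v \ot w \ot u)) -> (forall x y, P x -> P y -> P (x + y)) ->
  forall x, P x.
Proof.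
move=> P1 PD; apply: tens_ind => // t u; move: t.
by apply: tens_ind => // x y hx hy; rewrite linearDl; apply: PD.
Qed.

Lemma tens_ind3r (P : V \otimes (W \otimes U) -> Prop) :
  (forall v w u, P (v \ot (w \ot u))) -> (forall x y, P x -> P y -> P (x + y)) ->
  forall x, P x.
Proof.
move=> P1 PD; apply: tens_ind => // v; apply: tens_ind => // x y hx hy.
by rewrite linearDr; apply: PD.
Qed.

Lemma tassocK : cancel tassoc tassocV.
Proof.
apply: tens_ind3l => [v w u|x y hx hy]; first by rewrite tassocE tassocVE.
by rewrite !linearD /= hx hy.
Qed.

Lemma tassocVK : cancel tassocV tassoc.
Proof.
apply: tens_ind3r => [v w u|x y hx hy]; first by rewrite tassocVE tassocE.
by rewrite !linearD /= hx hy.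
Qed.

End Assoc.

Lemma tassoc_nat V V' W W' U U' (f : {linear V -> V'}) (g : {linear W -> W'})
    (h : {linear U -> U'}) t :
  tassoc (tmap (tmap f g) h t) = tmap f (tmap g h) (tassoc t).
Proof.
move: t; apply: tens_ind3l => [v w u|x y hx hy]; first by rewrite tmapE /= tmapE !tassocE tmapE /= tmapE.
by rewrite !linearD /= hx hy.
Qed.

Lemma tassocV_nat V V' W W' U U' (f : {linear V -> V'}) (g : {linear W -> W'})
    (h : {linear U -> U'}) t :
  tassocV (tmap f (tmap g h) t) = tmap (tmap f g) h (tassocV t).
Proof. by apply: (can_inj (@tassocK _ _ _)); rewrite tassoc_nat !tassocVK. Qed.

Section Units.
Variable V : lmodType K.

Definition tunitl_bilin (a : K^o) (v : V) : V := a *: v.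
Lemma tunitl_bilinear : bilinear_for *:%R *:%R tunitl_bilin.
Proof. by split=> [v|b] a x y; rewrite /tunitl_bilin /=; [rewrite scalerDl scalerA|rewrite scalerDr !scalerA mulrC]. Qed.
HB.instance Definition _ :=
  bilinear_isBilinear.Build K K^o V V *:%R *:%R tunitl_bilin tunitl_bilinear.

Definition tunitl : K^o \otimes V -> V := tlift tunitl_bilin.
HB.instance Definition _ := GRing.Linear.on tunitl.
Lemma tunitlE a v : tunitl (a \ot v) = a *: v.
Proof. exact: tliftE. Qed.

Definition tunitr_bilin (v : V) (a : K^o) : V := a *: v.
Lemma tunitr_bilinear : bilinear_for *:%R *:%R tunitr_bilin.
Proof. by split=> [b|v] a x y; rewrite /tunitr_bilin /=; [rewrite scalerDr !scalerA mulrC|rewrite scalerDl scalerA]. Qed.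
HB.instance Definition _ :=
  bilinear_isBilinear.Build K V K^o V *:%R *:%R tunitr_bilin tunitr_bilinear.

Definition tunitr : V \otimes K^o -> V := tlift tunitr_bilin.
HB.instance Definition _ := GRing.Linear.on tunitr.
Lemma tunitrE a v : tunitr (v \ot a) = a *: v.
Proof. exact: tliftE. Qed.

End Units.

Lemma tunitl_nat V W (f : {linear V -> W}) t :
  f (tunitl t) = tunitl (tmap idfun f t).
Proof.
move: t; apply: tens_ind => [a v|x y hx hy]; first by rewrite tmapE !tunitlE linearZ.
by rewrite !linearD /= hx hy.
Qed.

Lemma tunitr_nat V W (f : {linear V -> W}) t :
  f (tunitr t) = tunitr (tmap f idfun t).
Proof.
move: t; apply: tens_ind => [a v|x y hx hy]; first by rewrite tmapE !tunitrE linearZ.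
by rewrite !linearD /= hx hy.
Qed.

End TensorMaps.

Section Subspace.
Variables (K : fieldType) (V : lmodType K).

Record subspace := Subspace {
  subspace_mem :> {pred V};
  subspace_closed : submod_closed subspace_mem
}.

HB.instance Definition _ (P : subspace) :=
  GRing.isSubmodClosed.Build K V (subspace_mem P) (subspace_closed P).

Definition subsp (P : subspace) : Type := {v : V | v \in subspace_mem P}.

Variable P : subspace.
HB.instance Definition _ := [isSub of subsp P for @sval V (fun v => v \in subspace_mem P)].
HB.instance Definition _ := [Choice of subsp P by <:].
HB.instance Definition _ := [SubChoice_isSubLmodule of subsp P by <:].

Definition sincl (x : subsp P) : V := val x.
Lemma sincl_linear : linear sincl.
Proof. by move=> a x y; rewrite /sincl linearP. Qed.
HB.instance Definition _ := GRing.isLinear.Build K (subsp P) V *:%R sincl sincl_linear.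

#[global] Arguments sincl : simpl never.

Lemma sincl_inj : injective sincl.
Proof. exact: val_inj. Qed.

Lemma sinclP (x : subsp P) : sincl x \in subspace_mem P.
Proof. exact: valP. Qed.

End Subspace.

Section Complement.
Variables (K : fieldType) (V : lmodType K) (P : subspace V).

Let closedA (A : set V) := forall a x y, A x -> A y -> A (a *: x + y).
Let disjA (A : set V) := forall x, A x -> x \in subspace_mem P -> x = 0.

Let P0 : 0 \in subspace_mem P.
Proof. exact: rpred0. Qed.

Lemma complement_exists :
  exists A : set V, [/\ closedA A, disjA A &
    forall v, exists2 p, p \in subspace_mem P & A (v - p)].
Proof.
have [F FP Ftot|A [[clA dA] Amax]] :=
    @Zorn_bigcup V (fun A : set V => closedA A /\ disjA A).
  split=> [a x y [A FA Ax] [B FB By]|x [A FA Ax]]; last first.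
    by have [_] := FP _ FA; apply.
  have [AB|BA] := Ftot _ _ FA FB.
    by exists B => //; have [+ _] := FP _ FB; apply=> //; exact: AB.
  by exists A => //; have [+ _] := FP _ FA; apply=> //; exact: BA.
have A0 : A 0.
  have [//|nA0] := pselect (A 0); exfalso.
  have nA w : ~ A w.
    by move=> Aw; apply: nA0; have := clA (-1) _ _ Aw Aw; rewrite scaleN1r addNr.
  apply: (Amax (fun w => w = 0)); last first.
    by split=> [b s t -> ->|s ->]; rewrite ?scaler0 ?addr0.
  rewrite properEneq; split; last by move=> w /nA.
  by apply/eqP => AE; apply: nA0; rewrite AE.
have clZ a x : A x -> A (a *: x) by move=> Ax; rewrite -[_ *: _]addr0; apply: clA.
have ext v : (forall p, p \in subspace_mem P -> ~ A (v - p)) -> A v.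
  move=> hv; have [//|nAv] := pselect (A v); exfalso.
  pose B : set V := fun w => exists a x, A x /\ w = a *: v + x.
  apply: (Amax B); last split.
  - rewrite properEneq; split; last by move=> x Ax; exists 0, x; rewrite scale0r add0r.
    by apply/eqP => AB; apply: nAv; rewrite AB; exists 1, 0; rewrite scale1r addr0.
  - move=> a _ _ [b [x [Ax ->]]] [c [y [Ay ->]]].
    exists (a * b + c), (a *: x + y); split; first exact: clA.
    by rewrite scalerDr scalerDl !scalerA addrACA.
  - move=> _ [a [x [Ax ->]]] inP; have [a0|a0] := eqVneq a 0.
      by move: inP; rewrite a0 scale0r add0r; exact: dA.
    case: (hv (a^-1 *: (a *: v + x))); first by rewrite rpredZ.
    rewrite scalerDr scalerA mulVf // scale1r opprD addrA subrr add0r.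
    by rewrite -scaleNr; apply: clZ.
exists A; split=> // v.
have [[p pP Avp]|h] := pselect (exists2 p, p \in subspace_mem P & A (v - p)).
  by exists p.
exists 0 => //; rewrite subr0; apply: ext => p pP Avp; apply: h; by exists p.
Qed.

Lemma retraction_exists : exists r : {linear V -> subsp P}, cancel (@sincl _ _ P) r.
Proof.
have [A [clA dA decA]] := complement_exists.
have uniqA v (p q : subsp P) : A (v - sincl p) -> A (v - sincl q) -> p = q.
  move=> hp hq; apply: sincl_inj; apply/eqP; rewrite -subr_eq0; apply/eqP/dA.
    by have := clA (-1) _ _ hp hq; rewrite scaleN1r opprB addrA subrK.
  by apply: rpredB; apply: sinclP.
have decS v : {p : subsp P | A (v - sincl p)}.
  by apply: cid; have [p pP hp] := decA v; exists (exist _ p pP).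
pose r v := sval (decS v); have rP v : A (v - sincl (r v)) := svalP (decS v).
have rlin : linear r.
  move=> a x y; apply: (uniqA (a *: x + y)) => //.
  rewrite [sincl _]linearP opprD addrACA -scalerN -scalerDr; exact: clA.
have A0 : A 0 by have := clA (-1) _ _ (rP 0) (rP 0); rewrite scaleN1r addNr.
pose rL := GRing.isLinear.Build K V (subsp P) *:%R r rlin.
exists (HB.pack_for {linear V -> subsp P} r rL) => x /=.
by apply: (uniqA (sincl x)) => //; rewrite subrr.
Qed.

Definition sretr : {linear V -> subsp P} := sval (cid retraction_exists).

Lemma sretrK : cancel (@sincl _ _ P) sretr.
Proof. exact: svalP (cid retraction_exists). Qed.

Lemma sretr_id v : v \in subspace_mem P -> sincl (sretr v) = v.
Proof. by move=> vP; rewrite -[v]/(sincl (exist _ v vP)) sretrK. Qed.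

Lemma tmap_sincl_inj (W : lmodType K) :
  injective (tmap (@sincl _ _ P) (@idfun W)).
Proof.
apply: (can_inj (g := tmap sretr idfun)) => t.
by rewrite tmap_comp tmap_id // => v /=; rewrite sretrK.
Qed.

End Complement.

Section KerIm.
Variables (K : fieldType) (V W : lmodType K) (f : {linear V -> W}).

Definition kersp_mem : {pred V} := [pred v | f v == 0].
Lemma kersp_closed : submod_closed kersp_mem.
Proof.
split=> [|a x y]; rewrite !inE ?linear0 // => /eqP fx /eqP fy.
by rewrite linearP fx fy scaler0 addr0.
Qed.
Definition kersp := Subspace kersp_closed.

Definition imsp_mem : {pred W} := [pred w | `[< exists v, w = f v >]].
Lemma imsp_closed : submod_closed imsp_mem.
Proof.
split=> [|a x y]; rewrite !inE; first by exists 0; rewrite linear0.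
by move=> [v ->] [w ->]; exists (a *: v + w); rewrite linearP.
Qed.
Definition imsp := Subspace imsp_closed.

Lemma imsp_mem_f v : f v \in subspace_mem imsp.
Proof. by rewrite inE; exists v. Qed.

Definition imsp_proj (v : V) : subsp imsp := exist _ (f v) (imsp_mem_f v).

Lemma sincl_proj v : sincl (imsp_proj v) = f v. Proof. by []. Qed.

Lemma imsp_proj_linear : linear imsp_proj.
Proof. by move=> a x y; apply: sincl_inj; rewrite linearP !sincl_proj linearP. Qed.
HB.instance Definition _ :=
  GRing.isLinear.Build K V (subsp imsp) *:%R imsp_proj imsp_proj_linear.

Lemma imsp_proj_surj x : exists v, x = imsp_proj v.
Proof.
have := sinclP x; rewrite inE => -[v hv]; exists v; exact: sincl_inj.
Qed.

(* The kernel of f (x) 1 is (ker f) (x) U. *)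
Lemma ker_tmap (U : lmodType K) (t : V \otimes U) : tmap f idfun t = 0 ->
  t = tmap (@sincl _ _ kersp) idfun (tmap (sretr kersp) idfun t).
Proof.
pose h (v : V) : V := v - sincl (sretr kersp v).
have hlin a x y : h (a *: x + y) = a *: h x + h y.
  by rewrite /h linearP /= [sincl _]linearP opprD addrACA -scalerN -scalerDr.
have h0 v w : f v = f w -> h v = h w.
  move=> fvw; apply/eqP; rewrite -subr_eq0 -scaleN1r addrC -hlin scaleN1r addrC.
  by rewrite /h sretr_id ?subrr // inE linearB fvw subrr.
have sec w : {v | f v = sincl (sretr imsp w)}.
  by apply: cid; have := sinclP (sretr imsp w); rewrite inE => -[v ->]; exists v.
have [s sP] : {s : W -> V | forall w, f (s w) = sincl (sretr imsp w)}.
  by exists (fun w => sval (sec w)) => w; exact: svalP (sec w).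
pose g w := h (s w).
have glin : linear g.
  move=> a x y; rewrite -hlin; apply: h0.
  by rewrite [f (_ + _)]linearP !sP linearP.
pose gL := GRing.isLinear.Build K W V *:%R g glin.
pose G : {linear W -> V} := HB.pack_for {linear W -> V} g gL.
have Gf v : G (f v) = h v.
  by apply: h0; rewrite sP sretr_id // imsp_mem_f.
move=> ft0.
have -> : tmap (@sincl _ _ kersp) idfun (tmap (sretr kersp) idfun t) =
          t - tmap G idfun (tmap f idfun t).
  move: t {ft0}; apply: tens_ind => [v u|x y hx hy]; last first.
    by rewrite !linearD /= hx hy addrACA.
  rewrite !tmapE /= -[_ (f v)]/(G (f v)) Gf /h linearBl /= opprB addrC.
  by rewrite subrK.
by rewrite ft0 linear0 subr0.
Qed.

End KerIm.

Section Corestriction.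
Variables (K : fieldType) (V W : lmodType K) (f : {linear V -> W}) (P : subspace W).
Hypothesis fP : forall v, f v \in subspace_mem P.

Definition corestr (v : V) : subsp P := exist _ (f v) (fP v).

Lemma corestrE v : sincl (corestr v) = f v. Proof. by []. Qed.

Lemma corestr_linear : linear corestr.
Proof. by move=> a x y; apply: sincl_inj; rewrite linearP !corestrE linearP. Qed.
HB.instance Definition _ :=
  GRing.isLinear.Build K V (subsp P) *:%R corestr corestr_linear.

End Corestriction.

(* The quotient vector space V / P. *)
Section Quotient.
Variables (K : fieldType) (V : lmodType K) (P : subspace V).

Definition quot_rel (x y : V) := x - y \in subspace_mem P.

Lemma quot_rel_equiv : equiv_class_of quot_rel.
Proof.
split=> [x|x y|y x z]; rewrite /quot_rel.
- by rewrite subrr rpred0.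
- by rewrite -opprB rpredN.
- by move=> xy yz; rewrite -(subrK y x) -addrA rpredD.
Qed.

Canonical quot_equiv := EquivRelPack quot_rel_equiv.

Definition quotsp : Type := {eq_quot quot_equiv}.

HB.instance Definition _ := Choice.on quotsp.
HB.instance Definition _ := Quotient.on quotsp.
HB.instance Definition _ := EqQuotient.on quotsp.

Lemma quot_piP x y : (\pi_quotsp x = \pi_quotsp y) <-> x - y \in subspace_mem P.
Proof. by split=> [/eqquotP|h]; last exact/eqquotP. Qed.

Definition qadd (x y : quotsp) : quotsp := \pi_quotsp (repr x + repr y).
Definition qopp (x : quotsp) : quotsp := \pi_quotsp (- repr x).
Definition qscl (a : K) (x : quotsp) : quotsp := \pi_quotsp (a *: repr x).

Let reprP x : repr (\pi_quotsp x) - x \in subspace_mem P.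
Proof. by apply/quot_piP; rewrite reprK. Qed.

Lemma qaddE x y : qadd (\pi_quotsp x) (\pi_quotsp y) = \pi_quotsp (x + y).
Proof. by apply/quot_piP; rewrite opprD addrACA rpredD. Qed.
Lemma qoppE x : qopp (\pi_quotsp x) = \pi_quotsp (- x).
Proof. by apply/quot_piP; rewrite -opprD rpredN. Qed.
Lemma qsclE a x : qscl a (\pi_quotsp x) = \pi_quotsp (a *: x).
Proof. by apply/quot_piP; rewrite -scalerBr rpredZ. Qed.

Lemma qaddA : associative qadd.
Proof.
elim/quotW=> x; elim/quotW=> y; elim/quotW=> z.
by rewrite (qaddE y z) (qaddE x y) !qaddE addrA.
Qed.
Lemma qaddC : commutative qadd.
Proof. by elim/quotW=> x; elim/quotW=> y; rewrite !qaddE addrC. Qed.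
Lemma qadd0 : left_id (\pi_quotsp 0) qadd.
Proof. by elim/quotW=> x; rewrite qaddE add0r. Qed.
Lemma qaddN : left_inverse (\pi_quotsp 0) qopp qadd.
Proof. by elim/quotW=> x; rewrite (qoppE x) qaddE addNr. Qed.

HB.instance Definition _ := GRing.isZmodule.Build quotsp qaddA qaddC qadd0 qaddN.

Let qaddE' x y : \pi_quotsp x + \pi_quotsp y = \pi_quotsp (x + y).
Proof. exact: qaddE. Qed.

Lemma qsclA a b x : qscl a (qscl b x) = qscl (a * b) x.
Proof. by elim/quotW: x => x; rewrite (qsclE b x) !qsclE scalerA. Qed.
Lemma qscl1 : left_id 1 qscl.
Proof. by elim/quotW=> x; rewrite qsclE scale1r. Qed.
Lemma qsclDr : right_distributive qscl +%R.
Proof.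
move=> a; elim/quotW=> x; elim/quotW=> y.
by rewrite qaddE' (qsclE a x) (qsclE a y) qsclE qaddE' scalerDr.
Qed.
Lemma qsclDl x : {morph qscl^~ x : a b / a + b}.
Proof.
move=> a b; elim/quotW: x => x.
by rewrite (qsclE a x) (qsclE b x) qsclE qaddE' scalerDl.
Qed.

HB.instance Definition _ :=
  GRing.Zmodule_isLmodule.Build K quotsp qsclA qscl1 qsclDr qsclDl.

Definition qproj (x : V) : quotsp := \pi_quotsp x.

Lemma qproj_linear : linear qproj.
Proof. by move=> a x y; rewrite /qproj -qaddE -qsclE. Qed.
HB.instance Definition _ := GRing.isLinear.Build K V quotsp *:%R qproj qproj_linear.

Lemma qproj_surj x : exists v, x = qproj v.
Proof. by exists (repr x); rewrite /qproj reprK. Qed.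

Lemma qproj_eq0 v : (qproj v = 0) <-> v \in subspace_mem P.
Proof.
by rewrite -[0]/(\pi_quotsp 0) /qproj quot_piP subr0.
Qed.

Section QLift.
Variables (W : lmodType K) (f : {linear V -> W}).
Hypothesis f0 : forall v, v \in subspace_mem P -> f v = 0.

Definition qlift_fun & (forall v, v \in subspace_mem P -> f v = 0) :=
  fun x : quotsp => f (repr x).
Local Notation qlift := (qlift_fun f0).

Lemma qliftE v : qlift (qproj v) = f v.
Proof. by apply/eqP; rewrite -subr_eq0 -linearB f0 // reprP. Qed.

Lemma qlift_linear : linear qlift.
Proof.
move=> a x y; have [v ->] := qproj_surj x; have [w ->] := qproj_surj y.
by rewrite -linearP !qliftE linearP.
Qed.
HB.instance Definition _ := GRing.isLinear.Build K quotsp W *:%R qlift qlift_linear.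
End QLift.

End Quotient.

Record coalgebra (K : fieldType) := Coalgebra {
  coalg_space :> lmodType K;
  comul : {linear coalg_space -> coalg_space \otimes coalg_space};
  counit : {linear coalg_space -> K^o};
  comulA : forall c,
    tassoc (tmap comul idfun (comul c)) = tmap idfun comul (comul c);
  counitl : forall c, tunitl (tmap counit idfun (comul c)) = c;
  counitr : forall c, tunitr (tmap idfun counit (comul c)) = c
}.

Arguments comul {K c0}.
Arguments counit {K c0}.

(* Right comodules. *)
Record comodule (K : fieldType) (C : coalgebra K) := Comodule {
  comod_space :> lmodType K;
  coact : {linear comod_space -> comod_space \otimes C};
  coactA : forall m,
    tassoc (tmap coact idfun (coact m)) = tmap idfun comul (coact m);
  coact_counit : forall m, tunitr (tmap idfun counit (coact m)) = m
}.

Arguments coact {K C c}.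

(* (D, C)-bicomodules: a right C-coaction and a left D-coaction that commute. *)
Record bicomodule (K : fieldType) (D C : coalgebra K) := Bicomodule {
  bicomod_right :> comodule C;
  lcoact : {linear bicomod_right -> D \otimes bicomod_right};
  lcoactA : forall l,
    tassoc (tmap comul idfun (lcoact l)) = tmap idfun lcoact (lcoact l);
  lcoact_counit : forall l, tunitl (tmap counit idfun (lcoact l)) = l;
  bicoactA : forall l,
    tassoc (tmap lcoact idfun (coact l)) = tmap idfun coact (lcoact l)
}.

Arguments lcoact {K D C b}.

(* Two naturality squares from which all coassociativity laws below follow. *)
Section Squares.
Variable K : fieldType.
Variables X Y Z U V X' Y' Z' U' V' : lmodType K.

Lemma tassoc_squarel (a : {linear X -> Y \otimes Z}) (b : {linear Y -> U \otimes V})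
    (a' : {linear X' -> Y' \otimes Z'}) (b' : {linear Y' -> U' \otimes V'})
    (hx : {linear X -> X'}) (hy : {linear Y -> Y'}) (hz : {linear Z -> Z'})
    (hu : {linear U -> U'}) (hv : {linear V -> V'}) :
    (forall x, a' (hx x) = tmap hy hz (a x)) ->
    (forall y, b' (hy y) = tmap hu hv (b y)) ->
  forall x, tassoc (tmap b' idfun (a' (hx x))) =
            tmap hu (tmap hv hz) (tassoc (tmap b idfun (a x))).
Proof.
move=> ha hb x; rewrite ha -tassoc_nat !tmap_comp; congr tassoc.
by apply: eq_tmap => // y /=; rewrite hb.
Qed.

Lemma tassoc_squarer (a : {linear X -> Y \otimes Z}) (b : {linear Z -> U \otimes V})
    (a' : {linear X' -> Y' \otimes Z'}) (b' : {linear Z' -> U' \otimes V'})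
    (hx : {linear X -> X'}) (hy : {linear Y -> Y'}) (hz : {linear Z -> Z'})
    (hu : {linear U -> U'}) (hv : {linear V -> V'}) :
    (forall x, a' (hx x) = tmap hy hz (a x)) ->
    (forall z, b' (hz z) = tmap hu hv (b z)) ->
  forall x, tmap idfun b' (a' (hx x)) =
            tmap hy (tmap hu hv) (tmap idfun b (a x)).
Proof.
move=> ha hb x; rewrite ha !tmap_comp.
by apply: eq_tmap => // y /=; rewrite hb.
Qed.

End Squares.

(* C as a right comodule over itself. *)
Definition coreg (K : fieldType) (C : coalgebra K) : comodule C :=
  Comodule (@comulA K C) (@counitr K C).

Section Comodules.
Variables (K : fieldType) (C : coalgebra K).
Implicit Types M N : comodule C.

Record comod_hom M N := ComodHom {
  comod_hom_lin :> {linear M -> N};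
  comod_homP : forall m,
    coact (comod_hom_lin m) = tmap comod_hom_lin idfun (coact m)
}.

Definition comod_iso M N := exists f : comod_hom M N, bijective f.

Definition zero_comod M := forall m : M, m = 0.

(* P is a subcomodule when the coaction maps P into the image of P (x) C. *)
Record subcomod M := Subcomod {
  subcomod_space :> subspace M;
  subcomod_stable : forall m, m \in subspace_mem subcomod_space ->
    exists2 s : seq (M * C),
      all (fun p => p.1 \in subspace_mem subcomod_space) s &
      coact m = \sum_(p <- s) p.1 \ot p.2
}.

Section SubComod.
Variables (M : comodule C) (P : subcomod M).

Definition subc_incl : {linear subsp P -> M} := @sincl K M P.

(* The restriction of the coaction of M: see [subc_coactE]; the linear        *)
(* retraction [sretr P] of M onto P only serves to land in P (x) C.           *)
Definition subc_coact : {linear subsp P -> subsp P \otimes C} :=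
  tmap (sretr P) (@idfun C) \o (coact \o subc_incl).

Lemma subc_coactE x :
  coact (subc_incl x) = tmap subc_incl idfun (subc_coact x).
Proof.
have [s /allP sP e] := subcomod_stable (sinclP x).
rewrite /= tmap_comp e linear_sum; apply: eq_big_seq => p /sP pP.
by rewrite /= tmapE /= [sincl _]sretr_id.
Qed.

Lemma subc_coactA x : tassoc (tmap subc_coact idfun (subc_coact x)) =
  tmap idfun comul (subc_coact x).
Proof.
apply: (@tmap_sincl_inj K M P).
have h1 := tassoc_squarel subc_coactE subc_coactE x.
have id2 : forall z : C, comul (@idfun C z) = tmap idfun idfun (comul z).
  by move=> z; rewrite tmap_id.
have h2 := tassoc_squarer subc_coactE id2 x.
have e (t : subsp P \otimes (C \otimes C)) :
    tmap (@sincl _ _ P) idfun t = tmap subc_incl (tmap idfun idfun) t.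
  by apply: eq_tmap => [//|y]; rewrite /= tmap_id.
by rewrite !e -h1 -h2 coactA.
Qed.

Lemma subc_counit x : tunitr (tmap idfun counit (subc_coact x)) = x.
Proof.
apply: sincl_inj; rewrite [LHS]tunitr_nat tmap_comp.
transitivity (tunitr (tmap idfun counit (tmap subc_incl idfun (subc_coact x)))).
  by rewrite [in RHS]tmap_comp.
by rewrite -subc_coactE coact_counit.
Qed.

Definition subc : comodule C := Comodule subc_coactA subc_counit.

End SubComod.
End Comodules.

Section SubcomodConstructions.
Variables (K : fieldType) (C : coalgebra K).
Implicit Types M N : comodule C.

Lemma sincl_tensP (V : lmodType K) (P : subspace V) (u : subsp P \otimes C) :
  exists2 s : seq (V * C), all (fun p => p.1 \in subspace_mem P) s &
    tmap (@sincl K V P) idfun u = \sum_(p <- s) p.1 \ot p.2.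
Proof.
exists [seq (sincl p.1, p.2) | p <- repr u].
  by rewrite all_map; apply/allP => p _ /=; apply: sinclP.
rewrite {1}[u]tens_repr linear_sum big_map; apply: eq_bigr => p _.
by rewrite /= tmapE.
Qed.

Section KerImQuot.
Variables (M N : comodule C) (f : comod_hom M N).

Lemma chom_im_stable m : m \in subspace_mem (imsp f) ->
  exists2 s : seq (N * C), all (fun p => p.1 \in subspace_mem (imsp f)) s &
    coact m = \sum_(p <- s) p.1 \ot p.2.
Proof.
rewrite inE => -[v ->]; rewrite comod_homP.
have [s sP e] := sincl_tensP (tmap (imsp_proj f) idfun (coact v)).
by exists s => //; rewrite -e tmap_comp.
Qed.
Definition chom_im : subcomod N := Subcomod chom_im_stable.

Lemma chom_ker_stable m : m \in subspace_mem (kersp f) ->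
  exists2 s : seq (M * C), all (fun p => p.1 \in subspace_mem (kersp f)) s &
    coact m = \sum_(p <- s) p.1 \ot p.2.
Proof.
rewrite inE => /eqP fm0.
have /ker_tmap -> : tmap f idfun (coact m) = 0 by rewrite -comod_homP fm0 linear0.
exact: sincl_tensP.
Qed.
Definition chom_ker : subcomod M := Subcomod chom_ker_stable.

End KerImQuot.

Section QuotComod.
Variables (M : comodule C) (P : subcomod M).

Definition quotc_proj : {linear M -> quotsp P} := @qproj K M P.

Lemma quotc_coact_subproof v : v \in subspace_mem P ->
  (tmap quotc_proj idfun \o coact) v = 0.
Proof.
move=> /subcomod_stable[s /allP sP e]; rewrite /= e linear_sum big1_seq // => p.
move=> /andP[_ /sP pP]; rewrite /= tmapE.
by have -> : quotc_proj p.1 = 0 by [exact/qproj_eq0]; rewrite linear0l.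
Qed.

Definition quotc_coact : {linear quotsp P -> quotsp P \otimes C} :=
  qlift_fun quotc_coact_subproof.

Lemma quotc_coactE m :
  quotc_coact (quotc_proj m) = tmap quotc_proj idfun (coact m).
Proof. exact: qliftE. Qed.

Lemma quotc_coactA x : tassoc (tmap quotc_coact idfun (quotc_coact x)) =
  tmap idfun comul (quotc_coact x).
Proof.
have [m ->] := qproj_surj x.
have id2 : forall z : C, comul (@idfun C z) = tmap idfun idfun (comul z).
  by move=> z; rewrite tmap_id.
rewrite -[qproj _ _]/(quotc_proj _) (tassoc_squarel quotc_coactE quotc_coactE).
by rewrite (tassoc_squarer quotc_coactE id2) coactA.
Qed.

Lemma quotc_counit x : tunitr (tmap idfun counit (quotc_coact x)) = x.
Proof.
have [m ->] := qproj_surj x.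
by rewrite quotc_coactE tmap_comp -[in RHS](coact_counit m)
  -[qproj _ _]/(quotc_proj _) tunitr_nat tmap_comp.
Qed.


Definition quotc : comodule C := Comodule quotc_coactA quotc_counit.

End QuotComod.

End SubcomodConstructions.

Section Notions.
Variables (K : fieldType) (C : coalgebra K).
Implicit Types M N : comodule C.

Definition simple_comod M :=
  ~ zero_comod M /\
  forall P : subcomod M, (forall m, m \in subspace_mem P -> m = 0) \/
                         (forall m, m \in subspace_mem P).

Definition comod_embeds M N := exists P : subcomod N, comod_iso M (subc P).

(* The sum of all simple subcomodules of M. *)
Definition socle M : set M := [set m | exists2 s : seq M,
  (forall v, v \in s -> exists2 P : subcomod M,
      simple_comod (subc P) & v \in subspace_mem P) &
  m = \sum_(v <- s) v].

Arguments socle : clear implicits.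

(* A is the internal direct sum of the family F of subcomodules. *)
Definition is_direct_sum M (A : set M) (J : eqType) (F : J -> subcomod M) :=
  (forall m, A m <-> exists s : seq J, exists2 f : J -> M,
      (forall j, f j \in subspace_mem (F j)) & m = \sum_(j <- s) f j) /\
  (forall (s : seq J) (f : J -> M), uniq s ->
      (forall j, f j \in subspace_mem (F j)) ->
      \sum_(j <- s) f j = 0 -> forall j, j \in s -> f j = 0).

Definition basic_coalg :=
  exists (J : eqType) (F : J -> subcomod (coreg C)),
    [/\ is_direct_sum (socle (coreg C)) F,
        forall j, simple_comod (subc (F j)) &
        forall i j, comod_iso (subc (F i)) (subc (F j)) -> i = j].

Definition subcoalgebra (P : subspace C) := forall c, c \in subspace_mem P ->
  exists2 s : seq (C * C),
    all (fun p => (p.1 \in subspace_mem P) && (p.2 \in subspace_mem P)) s &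
    comul c = \sum_(p <- s) p.1 \ot p.2.

(* C is nonzero and not the direct sum of two nonzero subcoalgebras. *)
Definition indecomposable_coalg :=
  (exists c : C, c != 0) /\
  forall P Q : subspace C, subcoalgebra P -> subcoalgebra Q ->
    (forall c, c \in subspace_mem P -> c \in subspace_mem Q -> c = 0) ->
    (forall c, exists p q,
       [/\ p \in subspace_mem P, q \in subspace_mem Q & c = p + q]) ->
    (forall c, c \in subspace_mem P -> c = 0) \/
    (forall c, c \in subspace_mem Q -> c = 0).

Definition injective_comod E := forall (M N : comodule C)
    (f : comod_hom M N) (g : comod_hom M E), injective f ->
  exists h : comod_hom N E, forall m, h (f m) = g m.

Definition essential_mono M N (f : comod_hom M N) :=
  injective f /\
  forall P : subcomod N,
    (forall m, f m \in subspace_mem P -> f m = 0) ->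
    forall n, n \in subspace_mem P -> n = 0.

Definition injective_envelope M E (f : comod_hom M E) :=
  injective_comod E /\ essential_mono f.

Definition complete_simples (I : Type) (S : I -> comodule C) :=
  [/\ forall x, simple_comod (S x),
      forall x y, comod_iso (S x) (S y) -> x = y &
      forall M, simple_comod M -> exists x, comod_iso M (S x)].

End Notions.

Arguments socle {K C} M.

Section DualAction.
Variables (K : fieldType) (C : coalgebra K).
Implicit Types (f g : {linear C -> K^o}) (c : C).

(* The product of the dual algebra C^*: c |-> sum f(c_1) g(c_2). *)
Definition conv f g c : K^o := tunitl (tmap f g (comul c)).

(* ec = sum c_1 e(c_2) and ce = sum e(c_1) c_2. *)
Definition lact f c : C := tunitr (tmap idfun f (comul c)).
Definition ract f c : C := tunitl (tmap f idfun (comul c)).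

HB.instance Definition _ f := GRing.Linear.copy (lact f)
  (@tunitr K C \o (tmap (@idfun C) f \o comul)).
HB.instance Definition _ f := GRing.Linear.copy (ract f)
  (@tunitl K C \o (tmap f (@idfun C) \o comul)).

(* em = sum m_0 e(m_1). *)
Definition eact (M : comodule C) f (m : M) : M := tunitr (tmap idfun f (coact m)).
HB.instance Definition _ (M : comodule C) f := GRing.Linear.copy (@eact M f)
  (@tunitr K M \o (tmap (@idfun M) f \o coact)).

Record dual_idempotent := DualIdempotent {
  didem_fun :> {linear C -> K^o};
  didemP : forall c, conv didem_fun didem_fun c = didem_fun c
}.

Lemma tunitlr (t : K^o \otimes K^o) : tunitl t = tunitr t.
Proof.
move: t; apply: tens_ind => [a b|x y hx hy]; last by rewrite !linearD /= hx hy.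
by rewrite tunitlE tunitrE; exact: mulrC.
Qed.

Lemma lact_conv f g c : f (lact g c) = conv f g c.
Proof. by rewrite /lact tunitr_nat tmap_comp /conv tunitlr. Qed.

Lemma ract_conv f g c : g (ract f c) = conv f g c.
Proof. by rewrite /ract tunitl_nat tmap_comp. Qed.

Lemma tunitr_assoc (V W : lmodType K) f (t : (V \otimes W) \otimes C) :
  tunitr (tmap idfun f t) =
  tmap idfun (@tunitr K W \o tmap (@idfun W) f) (tassoc t).
Proof.
move: t; apply: tens_ind3l => [v w c|x y hx hy]; last first.
  by rewrite !linearD /= hx hy.
by rewrite tassocE !tmapE tunitrE /= tmapE tunitrE linearZr_LR.
Qed.

Lemma tunitl_assoc (V W : lmodType K) f (t : (C \otimes V) \otimes W) :
  tmap (@tunitl K V \o tmap f (@idfun V)) idfun t =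
  tunitl (tmap f idfun (tassoc t)).
Proof.
move: t; apply: tens_ind3l => [v w c|x y hx hy]; last first.
  by rewrite !linearD /= hx hy.
by rewrite tassocE !tmapE tunitlE /= tmapE tunitlE linearZl_LR.
Qed.

Lemma coact_eact (M : comodule C) f (m : M) :
  coact (eact f m) = tmap idfun (lact f) (coact m).
Proof.
rewrite /eact tunitr_nat tmap_comp.
transitivity (tunitr (tmap idfun f (tmap coact idfun (coact m)))).
  by rewrite tmap_comp; congr tunitr; apply: eq_tmap.
rewrite tunitr_assoc coactA tmap_comp.
by apply: eq_tmap.
Qed.

Lemma comul_lact f c : comul (lact f c) = tmap idfun (lact f) (comul c).
Proof. exact: (@coact_eact (coreg C) f c). Qed.

Lemma comul_ract f c : comul (ract f c) = tmap (ract f) idfun (comul c).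
Proof.
rewrite /ract tunitl_nat tmap_comp.
transitivity (tunitl (tmap f idfun (tmap idfun comul (comul c)))).
  by rewrite tmap_comp; congr tunitl; apply: eq_tmap.
rewrite -comulA -tunitl_assoc tmap_comp.
by apply: eq_tmap.
Qed.

Lemma eact_comp (M : comodule C) (e : dual_idempotent) (m : M) :
  eact e (eact e m) = eact e m.
Proof.
rewrite {1}/eact coact_eact tmap_comp; congr tunitr; apply: eq_tmap => // c /=.
by rewrite lact_conv didemP.
Qed.

Lemma lact_idem (e : dual_idempotent) c : lact e (lact e c) = lact e c.
Proof. exact: (@eact_comp (coreg C) e c). Qed.

Lemma ract_idem (e : dual_idempotent) c : ract e (ract e c) = ract e c.
Proof.
rewrite {1}/ract comul_ract tmap_comp; congr tunitl; apply: eq_tmap => // x /=.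
by rewrite ract_conv didemP.
Qed.

Lemma lact_ract f g c : lact f (ract g c) = ract g (lact f c).
Proof.
rewrite [LHS]/lact comul_ract tmap_comp.
by rewrite [lact f c]/lact tunitr_nat tmap_comp.
Qed.

End DualAction.

Section CornerCoalgebra.
Variables (K : fieldType) (C : coalgebra K) (e : dual_idempotent C).

(* c |-> ece = sum e(c_1) c_2 e(c_3) *)
Definition corner_map (c : C) : C := lact e (ract e c).
HB.instance Definition _ := GRing.Linear.copy corner_map (lact e \o ract e).

Local Notation eCe_sp := (subsp (imsp corner_map)).

Definition eCe_incl : {linear eCe_sp -> C} := @sincl K C (imsp corner_map).
Definition eCe_proj : {linear C -> eCe_sp} := @imsp_proj K C C corner_map.

Lemma eCe_inclK c : eCe_incl (eCe_proj c) = corner_map c. Proof. by []. Qed.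

Lemma eCe_proj_ract c : eCe_proj (ract e c) = eCe_proj c.
Proof. by apply: sincl_inj; rewrite !sincl_proj /= /corner_map ract_idem. Qed.
Lemma eCe_proj_lact c : eCe_proj (lact e c) = eCe_proj c.
Proof.
by apply: sincl_inj; rewrite !sincl_proj /= /corner_map -lact_ract lact_idem.
Qed.

(* By [eCe_comulE] this is ece |-> sum e c_1 e (x) e c_2 e. *)
Definition eCe_comul : {linear eCe_sp -> eCe_sp \otimes eCe_sp} :=
  tmap eCe_proj eCe_proj \o (comul \o eCe_incl).

Definition eCe_counit : {linear eCe_sp -> K^o} := counit \o eCe_incl.

Lemma eCe_comulE c : eCe_comul (eCe_proj c) = tmap eCe_proj eCe_proj (comul c).
Proof.
rewrite [LHS]/= -[sincl _]/(corner_map c) /corner_map comul_lact comul_ract !tmap_comp.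
by apply: eq_tmap => x; [exact: eCe_proj_ract|exact: eCe_proj_lact].
Qed.

Lemma eCe_counitE c : eCe_counit (eCe_proj c) = e c.
Proof.
rewrite [LHS]/= -[sincl _]/(corner_map c) /corner_map lact_conv /conv comul_ract tmap_comp.
transitivity (conv e e c); last exact: didemP.
rewrite -ract_conv -[in RHS](counitl (ract e c)) comul_ract tmap_comp.
rewrite tunitl_nat tmap_comp.
by congr tunitl; apply: eq_tmap.
Qed.

Lemma eCe_comulA x : tassoc (tmap eCe_comul idfun (eCe_comul x)) =
  tmap idfun eCe_comul (eCe_comul x).
Proof.
have [c ->] := imsp_proj_surj x.
rewrite -[imsp_proj _ c]/(eCe_proj c).
by rewrite (tassoc_squarel eCe_comulE eCe_comulE)
  (tassoc_squarer eCe_comulE eCe_comulE) comulA.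
Qed.

Lemma eCe_counitl x : tunitl (tmap eCe_counit idfun (eCe_comul x)) = x.
Proof.
have [c ->] := imsp_proj_surj x.
rewrite -[imsp_proj _ c]/(eCe_proj c) eCe_comulE tmap_comp -[in RHS]eCe_proj_ract.
rewrite tunitl_nat tmap_comp; congr tunitl; apply: eq_tmap => // z.
exact: eCe_counitE.
Qed.

Lemma eCe_counitr x : tunitr (tmap idfun eCe_counit (eCe_comul x)) = x.
Proof.
have [c ->] := imsp_proj_surj x.
rewrite -[imsp_proj _ c]/(eCe_proj c) eCe_comulE tmap_comp -[in RHS]eCe_proj_lact.
rewrite tunitr_nat tmap_comp; congr tunitr; apply: eq_tmap => // z.
exact: eCe_counitE.
Qed.

Definition eCe : coalgebra K := Coalgebra eCe_comulA eCe_counitl eCe_counitr.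

(* The quotient functor T, on objects: T(M) = eM. *)
Section QuotientFunctor.
Variable M : comodule C.

Local Notation eM := (subsp (imsp (@eact K C M e))).

Definition Tfun_incl : {linear eM -> M} := @sincl K M (imsp (@eact K C M e)).
Definition Tfun_proj : {linear M -> eM} := @imsp_proj K M M (@eact K C M e).

Lemma Tfun_inclK m : Tfun_incl (Tfun_proj m) = eact e m. Proof. by []. Qed.

(* By [Tfun_coactE] this is em |-> sum e m_0 (x) e m_1 e. *)
Definition Tfun_coact : {linear eM -> eM \otimes eCe} :=
  tmap Tfun_proj eCe_proj \o (coact \o Tfun_incl).

Lemma Tfun_proj_eact m : Tfun_proj (eact e m) = Tfun_proj m.
Proof. by apply: sincl_inj; rewrite !sincl_proj /= eact_comp. Qed.

Lemma Tfun_coactE m : Tfun_coact (Tfun_proj m) = tmap Tfun_proj eCe_proj (coact m).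
Proof.
rewrite [LHS]/= -[sincl _]/(eact e m) coact_eact !tmap_comp.
by apply: eq_tmap => // x; exact: eCe_proj_lact.
Qed.

Lemma Tfun_coactA x : tassoc (tmap Tfun_coact idfun (Tfun_coact x)) =
  tmap idfun comul (Tfun_coact x).
Proof.
have [m ->] := imsp_proj_surj x.
rewrite -[imsp_proj _ m]/(Tfun_proj m).
rewrite (tassoc_squarel Tfun_coactE Tfun_coactE) coactA.
by rewrite (tassoc_squarer Tfun_coactE eCe_comulE).
Qed.

Lemma Tfun_counit x : tunitr (tmap idfun counit (Tfun_coact x)) = x.
Proof.
have [m ->] := imsp_proj_surj x.
rewrite -[imsp_proj _ m]/(Tfun_proj m) Tfun_coactE tmap_comp -[in RHS]Tfun_proj_eact.
rewrite tunitr_nat tmap_comp; congr tunitr; apply: eq_tmap => // z.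
exact: eCe_counitE.
Qed.

Definition Tfun : comodule eCe := Comodule Tfun_coactA Tfun_counit.

End QuotientFunctor.

Local Notation Ce_sp := (subsp (imsp (ract e))).

Definition Ce_incl : {linear Ce_sp -> C} := @sincl K C (imsp (ract e)).
Definition Ce_proj : {linear C -> Ce_sp} := @imsp_proj K C C (ract e).

Lemma Ce_inclK c : Ce_incl (Ce_proj c) = ract e c. Proof. by []. Qed.
Lemma Ce_proj_ract c : Ce_proj (ract e c) = Ce_proj c.
Proof. by apply: sincl_inj; rewrite !sincl_proj /= ract_idem. Qed.

(* ce |-> sum c_1 e (x) c_2, see [Ce_coactE]. *)
Definition Ce_coact : {linear Ce_sp -> Ce_sp \otimes C} :=
  tmap Ce_proj (@idfun C) \o (comul \o Ce_incl).

(* ce |-> sum e c_1 e (x) c_2 e, see [Ce_lcoactE]. *)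
Definition Ce_lcoact : {linear Ce_sp -> eCe \otimes Ce_sp} :=
  tmap eCe_proj Ce_proj \o (comul \o Ce_incl).

Lemma Ce_coactE c : Ce_coact (Ce_proj c) = tmap Ce_proj idfun (comul c).
Proof.
rewrite [LHS]/= -[sincl _]/(ract e c) comul_ract !tmap_comp.
by apply: eq_tmap => // x; exact: Ce_proj_ract.
Qed.

Lemma Ce_lcoactE c : Ce_lcoact (Ce_proj c) = tmap eCe_proj Ce_proj (comul c).
Proof.
rewrite [LHS]/= -[sincl _]/(ract e c) comul_ract !tmap_comp.
by apply: eq_tmap => // x; exact: eCe_proj_ract.
Qed.

Lemma comul_idid c : comul (@idfun C c) = tmap idfun idfun (comul c).
Proof. by rewrite tmap_id. Qed.

Lemma Ce_coactA x : tassoc (tmap Ce_coact idfun (Ce_coact x)) =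
  tmap idfun comul (Ce_coact x).
Proof.
have [c ->] := imsp_proj_surj x.
rewrite -[imsp_proj _ c]/(Ce_proj c) (tassoc_squarel Ce_coactE Ce_coactE) comulA.
by rewrite (tassoc_squarer Ce_coactE comul_idid).
Qed.

Lemma Ce_counit x : tunitr (tmap idfun counit (Ce_coact x)) = x.
Proof.
have [c ->] := imsp_proj_surj x.
rewrite -[imsp_proj _ c]/(Ce_proj c) Ce_coactE tmap_comp -[in RHS](counitr c).
by rewrite tunitr_nat tmap_comp.
Qed.

Lemma Ce_lcoactA x : tassoc (tmap comul idfun (Ce_lcoact x)) =
  tmap idfun Ce_lcoact (Ce_lcoact x).
Proof.
have [c ->] := imsp_proj_surj x.
rewrite -[imsp_proj _ c]/(Ce_proj c) (tassoc_squarel Ce_lcoactE eCe_comulE) comulA.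
by rewrite (tassoc_squarer Ce_lcoactE Ce_lcoactE).
Qed.

Lemma Ce_lcounit x : tunitl (tmap counit idfun (Ce_lcoact x)) = x.
Proof.
have [c ->] := imsp_proj_surj x.
rewrite -[imsp_proj _ c]/(Ce_proj c) Ce_lcoactE tmap_comp -[in RHS]Ce_proj_ract.
rewrite tunitl_nat tmap_comp; congr tunitl; apply: eq_tmap => // z.
exact: eCe_counitE.
Qed.

Lemma Ce_bicoactA x : tassoc (tmap Ce_lcoact idfun (Ce_coact x)) =
  tmap idfun Ce_coact (Ce_lcoact x).
Proof.
have [c ->] := imsp_proj_surj x.
rewrite -[imsp_proj _ c]/(Ce_proj c) (tassoc_squarel Ce_coactE Ce_lcoactE) comulA.
by rewrite (tassoc_squarer Ce_lcoactE Ce_coactE).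
Qed.

Definition Ce : bicomodule eCe C :=
  @Bicomodule K eCe C (Comodule Ce_coactA Ce_counit) Ce_lcoact
    Ce_lcoactA Ce_lcounit Ce_bicoactA.

End CornerCoalgebra.

(* N (x) L as a right C-comodule through L. *)
Section RightTensor.
Variables (K : fieldType) (C : coalgebra K) (N : lmodType K) (L : comodule C).

Definition rtens_coact : {linear N \otimes L -> (N \otimes L) \otimes C} :=
  @tassocV K N L C \o tmap (@idfun N) coact.

Lemma rtens_coactE n l : rtens_coact (n \ot l) = tassocV (n \ot coact l).
Proof. by rewrite /= tmapE. Qed.

Lemma rtens_coactA t : tassoc (tmap rtens_coact idfun (rtens_coact t)) =
  tmap idfun comul (rtens_coact t).
Proof.
move: t; apply: tens_ind => [n l|x y hx hy]; last by rewrite !linearD /= hx hy.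
rewrite rtens_coactE.
have eA (x : L \otimes C) : tassoc (tmap rtens_coact idfun (tassocV (n \ot x))) =
    tassocV (n \ot tassoc (tmap coact idfun x)).
  move: x; apply: tens_ind => [l' c|x y hx hy]; last first.
    by rewrite !(linearD, linearDr) /= hx hy.
  rewrite tassocVE !tmapE rtens_coactE /=.
  move: (coact l'); apply: tens_ind => [l'' c'|x y hx hy].
    by rewrite tassocVE !tassocE tassocVE.
  rewrite linearDr linearD linearDl linearD /= hx hy.
  by rewrite linearDl linearD linearDr linearD.
have eB (x : L \otimes C) : tmap idfun comul (tassocV (n \ot x)) =
    tassocV (n \ot tmap idfun comul x) .
  move: x; apply: tens_ind => [l' c|x y hx hy]; last first.
    by rewrite !(linearD, linearDr) /= hx hy.
  rewrite tassocVE !tmapE /=.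
  move: (comul c); apply: tens_ind => [c' c''|x y hx hy].
    by rewrite tassocVE.
  by rewrite !(linearD, linearDr) /= hx hy.
by rewrite eA coactA -eB.
Qed.

Lemma rtens_counit t : tunitr (tmap idfun counit (rtens_coact t)) = t.
Proof.
move: t; apply: tens_ind => [n l|x y hx hy]; last by rewrite !linearD /= hx hy.
rewrite rtens_coactE -[in RHS](coact_counit l).
move: (coact l); apply: tens_ind => [l' c|x y hx hy].
  by rewrite tassocVE !tmapE !tunitrE /= linearZr_LR.
by rewrite !(linearD, linearDr) /= hx hy.
Qed.

Definition rtens : comodule C := Comodule rtens_coactA rtens_counit.

End RightTensor.

Section Cotensor.
Variables (K : fieldType) (D C : coalgebra K) (N : comodule D) (L : bicomodule D C).

(* N [] L is the equalizer of rho_N (x) 1 and 1 (x) lambda_L on N (x) L. *)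
Definition cotensor_l : {linear rtens N L -> N \otimes (D \otimes L)} :=
  @tassoc K N D L \o tmap coact (@idfun L).
Definition cotensor_r : {linear rtens N L -> N \otimes (D \otimes L)} :=
  tmap (@idfun N) lcoact.
Definition cotensor_map : {linear rtens N L -> N \otimes (D \otimes L)} :=
  cotensor_l \- cotensor_r.

Let G : {linear N \otimes (D \otimes L) -> (N \otimes (D \otimes L)) \otimes C} :=
  @tassocV K N (D \otimes L) C \o
  tmap (@idfun N) (@tassocV K D L C \o
    tmap (@idfun D) coact).

Let cotensor_lE n l : cotensor_l (n \ot l) = tassoc (coact n \ot l).
Proof. by rewrite /= tmapE. Qed.
Let cotensor_rE n l : cotensor_r (n \ot l) = n \ot lcoact l.
Proof. by rewrite /= tmapE. Qed.
Let GE n x : G (n \ot x) = tassocV (n \ot tassocV (tmap idfun coact x)).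
Proof. by rewrite /= tmapE. Qed.

Lemma cotensor_l_coact t : tmap cotensor_l idfun (coact t) = G (cotensor_l t).
Proof.
move: t; apply: tens_ind => [n l|x y hx hy]; last first.
  by move: hx hy; rewrite !linearD /= => -> ->.
rewrite [coact _]rtens_coactE cotensor_lE.
transitivity (tassocV (tmap (@idfun N) (@tassocV K D L C)
    (tassoc (coact n \ot (coact l : L \otimes C))))).
  move: (coact l); apply: tens_ind => [l' c|x y hx hy]; last first.
    by move: hx hy; rewrite !(linearD, linearDr) /= => -> ->.
  rewrite tassocVE tmapE cotensor_lE.
  move: (coact n); apply: tens_ind => [n' d|x y hx hy].
    by rewrite !tassocE tmapE /= !tassocVE.
  by move: hx hy; rewrite !(linearDl, linearD) /= => -> ->.
move: (coact n); apply: tens_ind => [n' d|x y hx hy].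
  by rewrite !tassocE GE !tmapE.
by move: hx hy; rewrite !(linearDl, linearD) /= => -> ->.
Qed.

Lemma cotensor_r_coact t : tmap cotensor_r idfun (coact t) = G (cotensor_r t).
Proof.
move: t; apply: tens_ind => [n l|x y hx hy]; last first.
  by move: hx hy; rewrite !linearD /= => -> ->.
rewrite [coact _]rtens_coactE cotensor_rE GE -bicoactA tassocK.
move: (coact l); apply: tens_ind => [l' c|x y hx hy].
  by rewrite tassocVE !tmapE cotensor_rE tassocVE.
by move: hx hy; rewrite !(linearD, linearDr) /= => -> ->.
Qed.

Lemma cotensor_stable t : t \in subspace_mem (kersp cotensor_map) ->
  exists2 s : seq (rtens N L * C),
    all (fun p => p.1 \in subspace_mem (kersp cotensor_map)) s &
    coact t = \sum_(p <- s) p.1 \ot p.2.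
Proof.
rewrite inE => /eqP t0.
have /ker_tmap -> : tmap cotensor_map idfun (coact t) = 0; last exact: sincl_tensP.
have -> (x : rtens N L \otimes C) : tmap cotensor_map idfun x =
    tmap cotensor_l idfun x - tmap cotensor_r idfun x.
  move: x; apply: tens_ind => [n l|x y hx hy]; last first.
    by rewrite !linearD /= hx hy addrACA.
  by rewrite !tmapE /= linearBl.
rewrite cotensor_l_coact cotensor_r_coact -linearB.
by rewrite -[_ - _]/(cotensor_map t) t0 linear0.
Qed.

Definition cotensor_subcomod : subcomod (rtens N L) := Subcomod cotensor_stable.

Definition cotensor : comodule C := subc cotensor_subcomod.

End Cotensor.

(* The section functor S, on objects: S(N) = N [] Ce. *)
Definition Sfun (K : fieldType) (C : coalgebra K) (e : dual_idempotent C)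
  (N : comodule (eCe e)) : comodule C := cotensor N (Ce e).

(* The unit M -> S(T(M)) of the adjunction, m |-> sum e m_0 (x) m_1 e. *)
Section Unit.
Variables (K : fieldType) (C : coalgebra K) (e : dual_idempotent C) (M : comodule C).

Let u : {linear M -> rtens (Tfun e M) (Ce e)} :=
  tmap (Tfun_proj e M) (Ce_proj e) \o coact.

Let uE m : u (idfun m) = tmap (Tfun_proj e M) (Ce_proj e) (coact m).
Proof. by []. Qed.

Let P := cotensor_subcomod (Tfun e M) (Ce e).

Lemma unit_mem m : u m \in subspace_mem P.
Proof.
rewrite inE subr_eq0; apply/eqP.
have h1 := tassoc_squarel uE (@Tfun_coactE K C e M) m.
have h2 := tassoc_squarer uE (@Ce_lcoactE K C e) m.
by apply: (etrans h1); apply: (etrans _ (esym h2)); rewrite coactA.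
Qed.

Definition unit_lin : {linear M -> Sfun (Tfun e M)} := corestr unit_mem.

Lemma unit_linE m : @sincl K _ P (unit_lin m) = u m. Proof. by []. Qed.

Lemma unit_coact m : coact (unit_lin m) = tmap unit_lin idfun (coact m).
Proof.
apply: (@tmap_sincl_inj K _ P).
apply: (etrans (esym (@subc_coactE K C _ P (unit_lin m)))).
apply: (etrans _ (esym (tmap_comp _ _ _ _ _))).
transitivity (tmap u idfun (coact m)); last by apply: eq_tmap.
transitivity (@rtens_coact K C _ (Ce e) (u m)); first by [].
rewrite /rtens_coact.
have h := tassoc_squarer uE (@Ce_coactE K C e) m.
apply: (etrans (congr1 (@tassocV _ _ _ _) h)).
rewrite -coactA tassocV_nat tassocK !tmap_comp.
by apply: eq_tmap.
Qed.

Definition adj_unit : comod_hom M (Sfun (Tfun e M)) := ComodHom unit_coact.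

(* For x in I_e, S_x embeds into S(S_x) = S(T(S_x)). *)
Lemma adj_unit_inj : simple_comod M -> ~ zero_comod (Tfun e M) ->
  injective adj_unit.
Proof.
move=> [_ simpM] TM0; have [k0|k1] := simpM (chom_ker adj_unit).
  move=> x y xy; apply/eqP; rewrite -subr_eq0; apply/eqP/k0.
  by rewrite inE linearB xy subrr.
case: TM0 => x; have [m ->] := imsp_proj_surj x.
have um0 : u m = 0.
  by have := k1 m; rewrite inE => /eqP/(congr1 (@sincl _ _ P)).
have ce c : counit (ract e c) = e c by rewrite ract_conv -lact_conv /lact counitr.
have Tm : tunitr (tmap idfun counit (tmap idfun (Ce_incl e) (u m))) =
          Tfun_proj e M m.
  rewrite -Tfun_proj_eact tunitr_nat /= !tmap_comp; congr tunitr.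
  by apply: eq_tmap => // c; exact: ce.
by rewrite -[LHS]Tm um0 !linear0.
Qed.

End Unit.

Definition I_e (K : fieldType) (C : coalgebra K) (e : dual_idempotent C)
    (I : Type) (simp : I -> comodule C) : set I :=
  [set x | ~ zero_comod (Tfun e (simp x))].

(* Main.v *)
(* Write N = T(S_x). A subcomodule of N (x) Ce killed by e is zero, and since N
   is simple, e S(N) = e S_x. Hence S(N) is an essential extension of S_x,
   e kills S(N)/S_x, and S(N) embeds into E_x over S_x: this gives one direction.
   Conversely, let P be the preimage in E_x of a copy of S_y in E_x/S_x, with
   T(S_y) = 0. Then eP lies in S_x, so a linear left inverse g of S_x -> E_x gives
   a colinear map p |-> sum e g(e p_0) (x) p_1 e from P to S(N). It extends the unit
   S_x -> S(T(S_x)), so it is injective by essentiality, and P/S_x embeds into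
   S(N)/S_x; the image of S_x in S(N) is the same for all embeddings. *)
Require Import Defs.
From mathcomp Require Import all_boot all_algebra.
From HB Require Import structures.
From mathcomp Require Import boolp.

Set Implicit Arguments.
Unset Strict Implicit.
Unset Printing Implicit Defensive.

Import GRing.Theory.
Local Open Scope ring_scope.

(** * Linear left inverses and injectivity of tensored maps *)

Section LinearMaps.
Variables (K : fieldType) (V W : lmodType K) (f : {linear V -> W}).

Lemma linear_linv : injective f -> exists g : {linear W -> V}, cancel f g.
Proof.
move=> f_inj.
pose inv (x : subsp (imsp f)) := sval (cid (imsp_proj_surj x)).
have invE x : sincl x = f (inv x).
  by rewrite [in LHS](svalP (cid (imsp_proj_surj x))).
pose g w := inv (sretr (imsp f) w).
have glin : linear g.
  by move=> a x y; apply: f_inj; rewrite linearP /= -!invE !linearP.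
exists (HB.pack_for {linear W -> V} g (GRing.isLinear.Build K W V *:%R g glin)).
by move=> v /=; apply: f_inj; rewrite -invE sretr_id // imsp_mem_f.
Qed.

Lemma tmap_injl (U : lmodType K) : injective f -> injective (tmap f (@idfun U)).
Proof.
move=> /linear_linv[g fK]; apply: (can_inj (g := tmap g idfun)) => t.
by rewrite tmap_comp tmap_id // => v /=; rewrite fK.
Qed.

Lemma tmap_injr (U : lmodType K) : injective f -> injective (tmap (@idfun U) f).
Proof.
move=> /linear_linv[g fK]; apply: (can_inj (g := tmap idfun g)) => t.
by rewrite tmap_comp tmap_id // => v /=; rewrite fK.
Qed.

Lemma linear_eq0 v : injective f -> f v = 0 -> v = 0.
Proof. by move=> f_inj fv0; apply: f_inj; rewrite fv0 linear0. Qed.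

Lemma linear_inj0 : (forall v, f v = 0 -> v = 0) -> injective f.
Proof.
by move=> f0 v w vw; apply/eqP; rewrite -subr_eq0; apply/eqP/f0; rewrite linearB vw subrr.
Qed.

Lemma tmap0l (V' W' : lmodType K) (g : {linear V' -> W'}) t :
  (forall v, f v = 0) -> tmap f g t = 0.
Proof.
move=> f0; move: t; apply: tens_ind => [v w|x y hx hy].
  by rewrite tmapE f0 linear0l.
by rewrite linearD /= hx hy addr0.
Qed.

End LinearMaps.

(** * Lifting, factoring and embedding of comodule homomorphisms *)

Section Homs.
Variables (K : fieldType) (C : coalgebra K).
Implicit Types M N A B D : comodule C.

Lemma comp_coact A B D (g : comod_hom B D) (f : comod_hom A B) a :
  coact ((g \o f) a) = tmap (g \o f) idfun (coact a).
Proof. by rewrite /= !comod_homP tmap_comp. Qed.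

Definition chom_comp A B D (g : comod_hom B D) (f : comod_hom A B) :
  comod_hom A D := ComodHom (comp_coact g f).

Definition subc_hom M (P : subcomod M) : comod_hom (subc P) M :=
  @ComodHom K C (subc P) M (subc_incl P) (@subc_coactE K C M P).

Lemma subc_hom_inj M (P : subcomod M) : injective (subc_hom P).
Proof. exact: sincl_inj. Qed.

Definition quotc_hom M (P : subcomod M) : comod_hom M (quotc P) :=
  @ComodHom K C M (quotc P) (quotc_proj P) (@quotc_coactE K C M P).

Lemma quotc_hom_eq0 M (P : subcomod M) m :
  quotc_hom P m = 0 <-> m \in subspace_mem P.
Proof. exact: qproj_eq0. Qed.

Lemma quotc_hom_surj M (P : subcomod M) x : exists m, x = quotc_hom P m.
Proof. exact: qproj_surj. Qed.

Lemma chom_eact A B (f : comod_hom A B) (e : {linear C -> K^o}) a :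
  f (eact e a) = eact e (f a).
Proof.
rewrite /eact comod_homP tunitr_nat !tmap_comp.
by congr tunitr; apply: eq_tmap.
Qed.

Lemma chom_imP A B (f : comod_hom A B) b :
  (b \in subspace_mem (chom_im f)) <-> exists a, b = f a.
Proof. by split=> [|h]; rewrite ?inE; [move=> /asboolP|apply/asboolP]. Qed.

(** A linear left inverse [r] of [i] gives [g = r \o f]; colinearity may be tested after [i] (x) 1,
    which is still injective over a field. *)
Lemma chom_lift A B D (i : comod_hom B D) (f : comod_hom A D) :
    injective i -> (forall a, exists b, f a = i b) ->
  exists g : comod_hom A B, forall a, i (g a) = f a.
Proof.
move=> i_inj fi; have [r iK] := linear_linv i_inj.
have rK a : i (r (f a)) = f a by have [b ->] := fi a; rewrite iK.
have gP a : coact ((r \o f) a) = tmap (r \o f) idfun (coact a).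
  apply: (tmap_injl (f := i)) => //; rewrite -comod_homP /= rK comod_homP tmap_comp.
  by apply: eq_tmap => // a' /=; rewrite rK.
by exists (ComodHom gP).
Qed.

Lemma chom_factor A B D (p : comod_hom A B) (f : comod_hom A D) :
    (forall b, exists a, b = p a) -> (forall a, p a = 0 -> f a = 0) ->
  exists g : comod_hom B D, forall a, g (p a) = f a.
Proof.
move=> p_surj pf; pose s b := sval (cid (p_surj b)).
have sE b : b = p (s b) := svalP (cid (p_surj b)).
have fE a a' : p a = p a' -> f a = f a'.
  move=> pa; apply/eqP; rewrite -subr_eq0 -linearB; apply/eqP/pf.
  by rewrite linearB pa subrr.
pose g b := f (s b).
have gE a : g (p a) = f a by apply: fE; rewrite -sE.
have glin : linear g.
  move=> a x y; rewrite [x]sE [y]sE -linearP !gE; exact: linearP.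
pose gL : {linear B -> D} :=
  HB.pack_for {linear B -> D} g (GRing.isLinear.Build K B D *:%R g glin).
have gP b : coact (gL b) = tmap gL idfun (coact b).
  rewrite [b]sE comod_homP tmap_comp [gL _]gE comod_homP.
  by apply: eq_tmap => // a; rewrite /= -gE.
by exists (ComodHom gP).
Qed.

Lemma comod_embedsP M N :
  comod_embeds M N <-> exists f : comod_hom M N, injective f.
Proof.
split=> [[P [f [g fK _]]]|[f f_inj]].
  exists (chom_comp (subc_hom P) f) => x y /=.
  by move=> /sincl_inj; exact: (can_inj fK).
exists (chom_im f).
have [f' f'E] : exists f' : comod_hom M (subc (chom_im f)),
    forall m, subc_hom (chom_im f) (f' m) = f m.
  apply: chom_lift => [|m]; first exact: subc_hom_inj.
  by exists (imsp_proj f m).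
exists f'; have h b : exists m, f' m = b.
  have [m mE] := imsp_proj_surj b; exists m.
  by apply: (@subc_hom_inj _ (chom_im f)); rewrite f'E mE.
exists (fun b => sval (cid (h b))) => [m|b]; last exact: svalP (cid (h b)).
by apply: f_inj; rewrite -!f'E (svalP (cid (h (f' m)))).
Qed.

Lemma zero_TfunP (e : dual_idempotent C) M :
  zero_comod (Tfun e M) <-> forall m : M, eact e m = 0.
Proof.
split=> [TM0 m|eM0 x]; first by rewrite -Tfun_inclK [Tfun_proj e M m]TM0 linear0.
have [m ->] := imsp_proj_surj x; apply: sincl_inj.
by rewrite sincl_proj linear0; exact: eM0.
Qed.

Lemma simple_ker M N (f : comod_hom M N) (m : M) : simple_comod M ->
  m != 0 -> f m = 0 -> forall m', f m' = 0.
Proof.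
move=> [_ simM] /eqP m0 fm0; have [k0|k1] := simM (chom_ker f).
  by case: m0; apply: k0; rewrite inE fm0.
by move=> m'; have := k1 m'; rewrite inE => /eqP.
Qed.

End Homs.

(** * Colinear maps into N (x) Ce and their evaluation *)

Section Induced.
Variables (K : fieldType) (C : coalgebra K) (e : dual_idempotent C).

Lemma counit_ract c : counit (ract e c) = e c.
Proof. by rewrite ract_conv -lact_conv /lact counitr. Qed.

Lemma Ce_surj (l : Ce e) : exists c, l = Ce_proj e c.
Proof. exact: imsp_proj_surj. Qed.

Lemma coact_Ce c : coact (Ce_proj e c : Ce e) = tmap (Ce_proj e) idfun (comul c).
Proof. exact: Ce_coactE. Qed.

Lemma lcoact_Ce c :
  lcoact (Ce_proj e c : Ce e) = tmap (eCe_proj e) (Ce_proj e) (comul c).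
Proof. exact: Ce_lcoactE. Qed.

Section Ind.
Variables (M : comodule C) (N : lmodType K) (b : {linear M -> N}).

(** This is m |-> sum b(m_0) (x) m_1 e. Any linear [b] gives a colinear map, since C coacts on N (x)
    Ce through Ce alone; [b = Tfun_proj] gives the unit of the adjunction. *)
Definition ind_lin : {linear M -> rtens N (Ce e)} := tmap b (Ce_proj e) \o coact.

Lemma ind_linP m : coact (ind_lin m) = tmap ind_lin idfun (coact m).
Proof.
have uE m' : ind_lin (idfun m') = tmap b (Ce_proj e) (coact m') by [].
have h := tassoc_squarer uE (@Ce_coactE K C e) m.
apply: (etrans (congr1 (@tassocV _ _ _ _) h)).
rewrite -coactA tassocV_nat tassocK !tmap_comp.
by apply: eq_tmap.
Qed.

Definition ind_hom : comod_hom M (rtens N (Ce e)) := ComodHom ind_linP.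

Lemma ind_homE m : ind_hom m = tmap b (Ce_proj e) (coact m).
Proof. by []. Qed.

End Ind.

Lemma ind_hom_chom (M M' : comodule C) (N : lmodType K) (b : {linear M' -> N})
    (f : comod_hom M M') m :
  ind_hom b (f m) = ind_hom (b \o f) m.
Proof. by rewrite !ind_homE comod_homP tmap_comp; apply: eq_tmap. Qed.

(* The hypothesis on b says that b induces an eCe-colinear map T(M) -> N. *)
Lemma ind_cotensor (M : comodule C) (N : comodule (eCe e)) (b : {linear M -> N}) :
    (forall m, coact (b m) = tmap b (eCe_proj e) (coact m)) ->
  forall m, ind_hom b m \in subspace_mem (cotensor_subcomod N (Ce e)).
Proof.
move=> bP m; rewrite inE subr_eq0; apply/eqP.
have uE m' : ind_lin b (idfun m') = tmap b (Ce_proj e) (coact m') by [].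
have h1 := tassoc_squarel uE bP m.
have h2 := tassoc_squarer uE (@Ce_lcoactE K C e) m.
by apply: (etrans h1); apply: (etrans _ (esym h2)); rewrite coactA.
Qed.

Section CoEval.
Variable N : lmodType K.

Definition coev : {linear rtens N (Ce e) -> N} :=
  @tunitr K N \o tmap (@idfun N) (counit \o Ce_incl e).

Lemma coevE n l : coev (n \ot l) = counit (Ce_incl e l) *: n.
Proof. by rewrite /= tmapE tunitrE. Qed.

(* So an element of N (x) Ce is determined by the values of coev on the
   subcomodule it generates. *)
Lemma coev_coact (t : rtens N (Ce e)) :
  tmap coev idfun (coact t) = tmap idfun (Ce_incl e) t.
Proof.
move: t; apply: tens_ind => [n l|x y hx hy]; last first.
  by move: hx hy; rewrite !linearD /= => -> ->.
have -> : coact (n \ot l : rtens N (Ce e)) = tassocV (n \ot coact l).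
  exact: rtens_coactE.
have [c ->] := Ce_surj l.
rewrite tmapE coact_Ce -[Ce_incl e _]/(ract e c).
rewrite /ract; move: (comul c); apply: tens_ind => [c1 c2|x y hx hy]; last first.
  by move: hx hy; rewrite !(linearD, linearDr) /= => -> ->.
rewrite !tmapE tassocVE tmapE /= tmapE tunitrE tunitlE /=.
by rewrite -[sincl _]/(ract e c1) counit_ract linearZl_LR linearZr_LR.
Qed.

Lemma coev_inj (t t' : rtens N (Ce e)) :
  tmap coev idfun (coact t) = tmap coev idfun (coact t') -> t = t'.
Proof. by rewrite !coev_coact; apply/tmap_injr/sincl_inj. Qed.

(** The counit and e agree on Ce: counit(ce) = e(c), and e(ce) = (e * e)(c) = e(c). *)
Lemma coev_eact (t : rtens N (Ce e)) : coev (eact e t) = coev t.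
Proof.
rewrite /eact tunitr_nat tmap_comp.
transitivity (tunitr (tmap idfun e (tmap coev idfun (coact t)))).
  by rewrite tmap_comp; congr tunitr; apply: eq_tmap.
rewrite coev_coact tmap_comp; congr tunitr; apply: eq_tmap => // l.
have [c ->] := Ce_surj l.
rewrite /= -[sincl _]/(ract e c) counit_ract ract_conv; exact: didemP.
Qed.

Lemma coev_ind (M : comodule C) (b : {linear M -> N}) m :
  coev (ind_hom b m) = b (eact e m).
Proof.
rewrite /eact tunitr_nat /coev /= !tmap_comp; congr tunitr.
by apply: eq_tmap => // c; exact: counit_ract.
Qed.

Lemma incl_eact (t : rtens N (Ce e)) :
  tmap idfun (Ce_incl e) (eact e t) = tmap idfun (lact e \o Ce_incl e) t.
Proof.
rewrite -coev_coact coact_eact tmap_comp.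
transitivity (tmap idfun (lact e) (tmap coev idfun (coact t))).
  by rewrite tmap_comp; apply: eq_tmap.
by rewrite coev_coact tmap_comp; apply: eq_tmap.
Qed.

End CoEval.

(** * The counit of the adjunction, and torsion-freeness of S(N) *)

Section SectionFunctor.
Variable N : comodule (eCe e).

Definition Sincl : comod_hom (Sfun N) (rtens N (Ce e)) :=
  subc_hom (cotensor_subcomod N (Ce e)).

Lemma Sincl_inj : injective Sincl. Proof. exact: sincl_inj. Qed.

(* On S(N), coev is the counit T(S(N)) -> N of the adjunction. *)
Lemma coact_coev (t : Sfun N) : coact (coev N (Sincl t)) =
  tmap idfun (eCe_proj e \o Ce_incl e) (Sincl t).
Proof.
(* Applying 1 (x) [ev], with [ev] : d (x) l |-> counit(l) d, to the equation defining the cotensor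
   product yields the claim. *)
pose ev := @tunitr K (eCe e) \o tmap (@idfun (eCe e)) (counit \o Ce_incl e).
have evl (s : rtens N (Ce e)) :
    tmap idfun ev (cotensor_l N (Ce e) s) = coact (coev N s).
  move: s; apply: tens_ind => [n l|x y hx hy]; last first.
    by move: hx hy; rewrite !linearD /= => -> ->.
  rewrite coevE linearZ /= tmapE.
  move: (coact n); apply: tens_ind => [n' d|x y hx hy]; last first.
    by rewrite linearDl !linearD /= hx hy.
  by rewrite tassocE tmapE /= tmapE tunitrE /= linearZr_LR.
have := sinclP t; rewrite inE subr_eq0 => /eqP/(congr1 (tmap idfun ev)).
move=> /(etrans (esym (evl _))) ->; rewrite /cotensor_r tmap_comp; apply: eq_tmap => // l.
have [c ->] := Ce_surj l.
rewrite [LHS]/(ev (lcoact (Ce_proj e c : Ce e))) lcoact_Ce /ev /=.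
rewrite -[sincl _]/(ract e c) eCe_proj_ract -[in RHS]eCe_proj_lact.
rewrite /lact tunitr_nat !tmap_comp; congr tunitr; apply: eq_tmap => // c'.
exact: counit_ract.
Qed.

(** Inside N (x) C, the element e t is the eCe-coaction of [coev t], hence depends on [coev t]
    alone. *)
Lemma eact_coev (t t' : Sfun N) : coev N (Sincl t) = coev N (Sincl t') ->
  eact e t = eact e t'.
Proof.
move=> tt'; apply: Sincl_inj; rewrite !chom_eact.
apply: (tmap_injr (f := Ce_incl e)); first exact: sincl_inj.
have E (s : Sfun N) : tmap idfun (Ce_incl e) (eact e (Sincl s)) =
    tmap idfun (eCe_incl e) (coact (coev N (Sincl s))).
  rewrite incl_eact coact_coev tmap_comp; apply: eq_tmap => // l.
  have [c ->] := Ce_surj l.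
  by rewrite /= -[sincl _]/(ract e c) -[sincl _]/(corner_map e (ract e c)) /corner_map ract_idem.
by rewrite !E tt'.
Qed.

(** Here e kills ker f, so [coev] vanishes on ker f by [coev_eact]. For t in ker f the coaction of t
    lies in ker f (x) C, and [coev_inj] gives t = 0. *)
Lemma Sfun_torsion_free (M : comodule C) (f : comod_hom (Sfun N) M) :
  (forall t, f t = 0 -> eact e t = 0) -> injective f.
Proof.
move=> fe; apply: linear_inj0 => t ft0; apply: Sincl_inj; apply: coev_inj.
rewrite [in RHS]linear0 linear0 linear0 comod_homP tmap_comp.
have /ker_tmap -> : tmap f idfun (coact t) = 0 by rewrite -comod_homP ft0 linear0.
rewrite tmap_comp tmap0l // => k.
have k0 : f (sincl k) = 0 by have := sinclP k; rewrite inE => /eqP.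
rewrite -[LHS]/(coev N (Sincl (sincl k))) -coev_eact -chom_eact fe //.
by rewrite !linear0.
Qed.

End SectionFunctor.

(** * The e-part of S(T(S)) for a simple comodule S *)

Section SimpleComodule.
Variable S : comodule C.
Hypothesis S_simple : simple_comod S.

(* An eCe-colinear endomorphism of T(S) is regarded as a map on all of S; its
   cokernel induces a C-colinear map on S, which is zero or injective. *)
Lemma Tfun_endo_surj (h : {linear S -> Tfun e S}) (m0 : S) :
    (forall m, coact (h m) = tmap h (eCe_proj e) (coact m)) -> h m0 <> 0 ->
  forall n, exists m, n = h m.
Proof.
move=> hP hm0 n.
pose q : {linear Tfun e S -> quotsp (imsp h)} := @qproj K (Tfun e S) (imsp h).
have qh m : q (h m) = 0 by apply/qproj_eq0; rewrite imsp_mem_f.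
pose g := ind_hom (q \o Tfun_proj e S).
pose m1 : S := Tfun_incl e S (h m0).
have em1 : eact e m1 = m1.
  have [m mE] := imsp_proj_surj (h m0).
  by rewrite /m1 mE -[imsp_proj _ _]/(Tfun_proj e S m) Tfun_inclK eact_comp.
(* In (T(S)/im h) (x) C, the element g(m1) is the image of the eCe-coaction of h(m0), which factors
   through q o h = 0. *)
have gm1 : g m1 = 0.
  apply: (tmap_injr (f := Ce_incl e)); first exact: sincl_inj.
  rewrite [RHS]linear0.
  transitivity (tmap q (eCe_incl e) (coact (h m0))); last first.
    by rewrite hP tmap_comp tmap0l.
  rewrite ind_homE -em1 coact_eact -[coact (h m0)]/(Tfun_coact e S (h m0)) !tmap_comp.
  by apply: eq_tmap => // c; rewrite /= -[RHS]/(corner_map e c) /corner_map lact_ract.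
(* As m1 is nonzero, simplicity of S forces g = 0, and q is recovered from g by [coev]. *)
have g0 := simple_ker S_simple _ gm1.
have q0 m : q (Tfun_proj e S m) = 0.
  rewrite -Tfun_proj_eact -[LHS]/((q \o Tfun_proj e S) (eact e m)) -coev_ind.
  rewrite [ind_hom _ m]g0 ?linear0 //; apply/eqP => m10; apply: hm0.
  by apply: sincl_inj; rewrite linear0.
have [m nE] := imsp_proj_surj n.
have : q n = 0 by rewrite nE; exact: q0.
by move/qproj_eq0; rewrite inE => /asboolP.
Qed.

(** [coev] composed with [j] is nonzero, otherwise [j] would vanish; so it is onto T(S) by
    [Tfun_endo_surj]. Thus t and some j(s) have the same [coev], hence the same e-part. *)
Lemma Sfun_eact (j : comod_hom S (Sfun (Tfun e S))) : injective j ->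
  forall t, exists s, eact e t = j (eact e s).
Proof.
move=> j_inj t; pose h := coev (Tfun e S) \o (Sincl (Tfun e S) \o j).
have hP m : coact (h m) = tmap h (eCe_proj e) (coact m).
  rewrite [LHS]coact_coev.
  transitivity (tmap idfun (eCe_proj e) (tmap idfun (Ce_incl e) (Sincl (Tfun e S) (j m)))).
    by rewrite tmap_comp; apply: eq_tmap.
  by rewrite -coev_coact !comod_homP !tmap_comp; apply: eq_tmap.
have [S0 _] := S_simple.
have [m0 hm0] : exists m0, h m0 <> 0.
  apply: contrapT => /forallNP h0; apply: S0 => m; apply: j_inj.
  apply: Sincl_inj; apply: coev_inj; rewrite !linear0 !comod_homP !tmap_comp.
  by rewrite tmap0l // => s; apply: contrapT; exact: h0.
have [s sE] := Tfun_endo_surj hP hm0 (coev (Tfun e S) (Sincl (Tfun e S) t)).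
by exists s; rewrite chom_eact; apply: eact_coev.
Qed.

(** The e-part of S(T(S)) lies in the image of [j'], so S -> S(T(S))/im j' induced by [j] kills some
    e s0 <> 0, hence all of S. *)
Lemma Sfun_im_sub (j j' : comod_hom S (Sfun (Tfun e S))) :
    ~ zero_comod (Tfun e S) -> injective j -> injective j' ->
  forall s, exists s', j s = j' s'.
Proof.
move=> TS0 j_inj j'_inj s.
have [s0 es0] : exists s0 : S, eact e s0 <> 0.
  by apply: contrapT => /forallNP h; apply/TS0/zero_TfunP => m; apply: contrapT (h m).
have [s1 s1E] := Sfun_eact j'_inj (j s0).
pose f := chom_comp (quotc_hom (chom_im j')) j.
have : f s = 0.
  apply: (@simple_ker _ _ _ _ f (eact e s0)) => //; first exact/eqP.
  by apply/quotc_hom_eq0/chom_imP; exists (eact e s1); rewrite -s1E chom_eact.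
by move/quotc_hom_eq0/chom_imP.
Qed.

End SimpleComodule.

End Induced.

Theorem theorem3p7 (K : fieldType) (C : coalgebra K)
    (C_basic : basic_coalg C) (C_indec : indecomposable_coalg C)
    (e : dual_idempotent C)
    (I : Type) (simp : I -> comodule C) (simpP : complete_simples simp)
    (* E x is the injective envelope of S_x, embedded by i x *)
    (E : I -> comodule C) (i : forall x : I, comod_hom (simp x) (E x))
    (E_env : forall x : I, injective_envelope (i x))
    (y x : I) (x_in_Ie : I_e e simp x)
    (* S_x as a subcomodule of S(S_x), where the simple eCe-comodule S_x is T(S_x) *)
    (j : comod_hom (simp x) (Sfun (Tfun e (simp x)))) (j_inj : injective j) :
  comod_embeds (simp y) (quotc (chom_im j)) <->
  comod_embeds (simp y) (quotc (chom_im (i x))) /\ zero_comod (Tfun e (simp y)).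
Proof.
have [simple_S _ _] := simpP.
have [E_inj [i_inj i_ess]] := E_env x.
split.
  case/comod_embedsP=> f f_inj; split.
    have [h hj] := E_inj _ _ j (i x) j_inj.
    have h_inj : injective h.
      (* If h(t) = 0, write e t = j(e s); then i(e s) = h(e t) = 0, so e s = 0. *)
      apply: Sfun_torsion_free => t ht0.
      have [s sE] := Sfun_eact (simple_S x) j_inj t.
      have : h (eact e t) = 0 by rewrite chom_eact ht0 linear0.
      by rewrite sE hj => /(linear_eq0 i_inj) ->; rewrite linear0.
    have [g gE] : exists g : comod_hom (quotc (chom_im j)) (quotc (chom_im (i x))),
        forall t, g (quotc_hom (chom_im j) t) = quotc_hom (chom_im (i x)) (h t).
      apply: (@chom_factor _ _ _ _ _ _ (chom_comp (quotc_hom (chom_im (i x))) h)).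
        exact: quotc_hom_surj.
      move=> t /quotc_hom_eq0/chom_imP[s ->]; apply/quotc_hom_eq0/chom_imP.
      by exists s; rewrite hj.
    apply/comod_embedsP; exists (chom_comp g f); apply: inj_comp f_inj.
    apply: linear_inj0 => z; have [t ->] := quotc_hom_surj z.
    rewrite gE => /quotc_hom_eq0/chom_imP[s]; rewrite -hj => /h_inj ->.
    by apply/quotc_hom_eq0/chom_imP; exists s.
  (* The e-part of S(S_x) lies in the image of S_x, so e kills the quotient and therefore S_y. *)
  apply/zero_TfunP => m; apply: f_inj; rewrite chom_eact linear0.
  have [t ->] := quotc_hom_surj (f m); rewrite -chom_eact.
  have [s ->] := Sfun_eact (simple_S x) j_inj t.
  by apply/quotc_hom_eq0/chom_imP; exists (eact e s).
case=> /comod_embedsP[f f_inj] /zero_TfunP Ty0.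
pose q := quotc_hom (chom_im (i x)).
pose P := chom_ker (chom_comp (quotc_hom (chom_im f)) q).
have PP p : p \in subspace_mem P <-> exists s, q p = f s.
  rewrite inE; split=> [/eqP/quotc_hom_eq0/chom_imP //|/chom_imP/quotc_hom_eq0/eqP //].
have [g iK] := linear_linv i_inj.
(* Defining [b] on all of [E x] makes [k] colinear there, so that essentiality of S_x applies to its
   kernel; values in S(T(S_x)) are obtained only on P. *)
pose b : {linear E x -> Tfun e (simp x)} := Tfun_proj e (simp x) \o (g \o @eact K C (E x) e).
pose k := ind_hom e b.
have ki s : k (i x s) = sincl (adj_unit e (simp x) s).
  rewrite /k ind_hom_chom ind_homE; apply: eq_tmap => // s'.
  by rewrite /= -chom_eact iK; exact: Tfun_proj_eact.
have u_inj := adj_unit_inj (simple_S x) x_in_Ie.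
have k_inj : injective k.
  apply: linear_inj0 => p kp0; apply: (i_ess (chom_ker k)); last by rewrite inE kp0.
  move=> s; rewrite inE ki => /eqP/(linear_eq0 (@sincl_inj _ _ _))/(linear_eq0 u_inj) ->.
  exact: linear0.
(* Since q maps P into the copy of S_y, which e kills, eP lies in ker q = i(S_x). *)
have eP (p : subc P) : i x (g (eact e (subc_hom P p))) = eact e (subc_hom P p).
  have /PP[s qs] := sinclP p.
  have : q (eact e (subc_hom P p)) = 0 by rewrite chom_eact [q _]qs -chom_eact Ty0 linear0.
  by move=> /quotc_hom_eq0/chom_imP[s' ->]; rewrite iK.
have bP (p : subc P) : coact ((b \o subc_hom P) p) =
    tmap (b \o subc_hom P) (eCe_proj e) (coact p).
  (* After embedding T(S_x) into [E x], [b] restricted to P becomes p |-> e p by [eP]. *)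
  apply: (tmap_injl (f := i x \o Tfun_incl e (simp x))).
    by apply: inj_comp i_inj _; exact: sincl_inj.
  rewrite [coact ((b \o _) p)]Tfun_coactE [LHS]tmap_comp [RHS]tmap_comp.
  transitivity (tmap (@eact K C (E x) e) (eCe_proj e)
      (coact (i x (g (eact e (subc_hom P p)))))).
    rewrite comod_homP tmap_comp; apply: eq_tmap => // s.
    exact: chom_eact.
  rewrite eP coact_eact comod_homP; move: (coact p) => z.
  rewrite !tmap_comp; apply: eq_tmap => [p'|c].
    by rewrite /= -[RHS]/(i x (eact e (g (eact e (subc_hom P p'))))) chom_eact eP eact_comp.
  exact: eCe_proj_lact.
have kP (p : subc P) : k (subc_hom P p) \in
    subspace_mem (cotensor_subcomod (Tfun e (simp x)) (Ce e)).
  by rewrite /k ind_hom_chom; apply: ind_cotensor.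
have [k' k'E] : exists k' : comod_hom (subc P) (Sfun (Tfun e (simp x))),
    forall p, Sincl _ (k' p) = k (subc_hom P p).
  apply: (@chom_lift _ _ _ _ _ _ (chom_comp k (subc_hom P))) => [|p].
    exact: Sincl_inj.
  by exists (corestr (f := k \o subc_hom P) kP p).
have [r rE] : exists r : comod_hom (subc P) (simp y),
    forall p, f (r p) = q (subc_hom P p).
  apply: (@chom_lift _ _ _ _ _ _ (chom_comp q (subc_hom P))) => // p.
  exact/PP/sinclP.
(* P -> S_y and P -> S(S_x)/S_x have the same kernel: [k] carries i(S_x) onto the image of the unit,
   which is that of [j]. *)
have jk p : k' p \in subspace_mem (chom_im j) <-> r p = 0.
  split=> [/chom_imP[s k'p]|rp0].
    have [s' ss'] := Sfun_im_sub (simple_S x) x_in_Ie j_inj u_inj s.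
    apply: f_inj; rewrite rE linear0; apply/quotc_hom_eq0/chom_imP; exists s'.
    by apply: k_inj; rewrite ki -k'E k'p ss'.
  have : q (subc_hom P p) = 0 by rewrite -rE rp0 linear0.
  move=> /quotc_hom_eq0/chom_imP[s pE]; apply/chom_imP.
  have [s' ss'] := Sfun_im_sub (simple_S x) x_in_Ie u_inj j_inj s.
  by exists s'; apply: Sincl_inj; rewrite k'E pE ki ss'.
have r_surj s : exists p, s = r p.
  have [p pE] := quotc_hom_surj (f s).
  have pP : p \in subspace_mem P by apply/PP; exists s; rewrite pE.
  by exists (exist _ p pP : subc P); apply: f_inj; rewrite rE pE.
have [h hE] : exists h : comod_hom (simp y) (quotc (chom_im j)),
    forall p, h (r p) = quotc_hom (chom_im j) (k' p).
  apply: (@chom_factor _ _ _ _ _ _ (chom_comp (quotc_hom (chom_im j)) k')) => // p.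
  by move=> /jk/quotc_hom_eq0.
apply/comod_embedsP; exists h; apply: linear_inj0 => s.
by have [p ->] := r_surj s; rewrite hE => /quotc_hom_eq0/jk.
Qed.
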